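(* Let $G$ be a Lie group acting properly, freely and smoothly (on the right) on a smooth manifold $X$. Then each orbit in $X$ is diffeomorphic to $G$, and for each $x\in X$ the restriction of the translation map to the orbit of $x$, $\tau_x\colon x\cdot G\to G$, $x\cdot g\mapsto \tau(x,x\cdot g)=g$, is smooth.
   Context: Smooth manifolds are Hausdorff and second countable. A continuous action of $G$ on $X$ is proper if the map $X\times G\to X\times X$, $(x,g)\mapsto(x,x\cdot g)$, is proper (for manifolds: preimages of compact sets are compact). Under the stated hypotheses each orbit $x\cdot G$ is an embedded submanifold of $X$, and this is the smooth structure used on the orbit. For a free action the translation map $\tau$ is defined on pairs $(x,y)$ in the same orbit by: $\tau(x,y)$ is the unique $g\in G$ with $y=x\cdot g$. *)

(* Defs.v *)
From HB Require Import structures.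
From mathcomp Require Import all_boot all_order all_algebra.
From mathcomp Require Import all_classical all_reals all_analysis.

Set Implicit Arguments.
Unset Strict Implicit.
Unset Printing Implicit Defensive.

Import GRing.Theory numFieldNormedType.Exports.

Local Open Scope classical_set_scope.
Local Open Scope ring_scope.

(* [W] is meant to be open and [f] is a total function of which only the values
   on [W] matter: continuity and directional derivatives at a point of an open
   set [W] depend only on the restriction of [f] to [W]. *)
Fixpoint Ck_on (R : realType) (n m k : nat) (W : set 'rV[R]_n)
    (f : 'rV[R]_n -> 'rV[R]_m) : Prop :=
  (forall u, W u -> {for u, continuous f}) /\
  match k with
  | 0%N => True
  | k'.+1 => forall i : 'I_n,
      (forall u, W u -> derivable f u (delta_mx 0 i)) /\
      Ck_on k' W ('D_(delta_mx 0 i) f)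
  end.

Definition smooth_on (R : realType) (n m : nat) (W : set 'rV[R]_n)
    (f : 'rV[R]_n -> 'rV[R]_m) : Prop :=
  forall k, Ck_on k W f.

(* A homeomorphism from an open subset of [X] onto an open subset of R^n. Both
   [chart_fun] and [chart_inv] are total functions, with irrelevant values
   outside [chart_dom] and outside its image, respectively. *)
Record chart (R : realType) (n : nat) (X : topologicalType) := Chart {
  chart_dom : set X;
  chart_fun :> X -> 'rV[R]_n;
  chart_inv : 'rV[R]_n -> X;
  chart_dom_open : open chart_dom;
  chart_img_open : open (chart_fun @` chart_dom);
  chart_funK : {in chart_dom, cancel chart_fun chart_inv};
  chart_fun_cts : forall x, chart_dom x -> {for x, continuous chart_fun};
  chart_inv_cts : forall u, (chart_fun @` chart_dom) u ->
    {for u, continuous chart_inv}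
}.

Definition chart_compatible (R : realType) (n : nat) (X : topologicalType)
    (c d : chart R n X) : Prop :=
  smooth_on (c @` (chart_dom c `&` chart_dom d)) (d \o chart_inv c) /\
  smooth_on (d @` (chart_dom c `&` chart_dom d)) (c \o chart_inv d).

Record smooth_manifold (R : realType) (n : nat) (X : topologicalType)
    (A : set (chart R n X)) : Prop := SmoothManifold {
  manifold_hausdorff : hausdorff_space X;
  manifold_second_countable : @second_countable X;
  manifold_cover : forall x : X, exists2 c, A c & chart_dom c x;
  manifold_compatible : forall c d, A c -> A d -> chart_compatible c d
}.

Definition maximal_atlas (R : realType) (n : nat) (X : topologicalType)
    (A : set (chart R n X)) : set (chart R n X) :=
  [set c | forall d, A d -> chart_compatible c d].

Definition smooth_map (R : realType) (n m : nat) (X Y : topologicalType)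
    (A : set (chart R n X)) (B : set (chart R m Y)) (f : X -> Y) : Prop :=
  continuous f /\
  forall c d, A c -> B d ->
    smooth_on (c @` (chart_dom c `&` f @^-1` chart_dom d))
              (d \o f \o chart_inv c).

Definition diffeomorphic (R : realType) (n m : nat) (X Y : topologicalType)
    (A : set (chart R n X)) (B : set (chart R m Y)) : Prop :=
  exists f : X -> Y, exists g : Y -> X,
    [/\ cancel f g, cancel g f, smooth_map A B f & smooth_map B A g].

Definition prod_atlas (R : realType) (n m : nat) (X Y : topologicalType)
    (A : set (chart R n X)) (B : set (chart R m Y)) :
    set (chart R (n + m) (X * Y)%type) :=
  [set e | exists c d, [/\ A c, B d,
    chart_dom e = chart_dom c `*` chart_dom d &
    forall p, chart_dom e p -> e p = row_mx (c p.1) (d p.2)]].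

(* [c] maps [S] onto the slice R^k x {0} of its image. *)
Definition slice_chart (R : realType) (n : nat) (X : topologicalType)
    (A : set (chart R n X)) (k : nat) (S : set X) (c : chart R n X) : Prop :=
  maximal_atlas A c /\
  c @` (chart_dom c `&` S) =
  (c @` chart_dom c) `&`
    [set u : 'rV[R]_n | forall i : 'I_n, (k <= i)%N -> u 0 i = 0].

Definition embedded_submanifold (R : realType) (n : nat) (X : topologicalType)
    (A : set (chart R n X)) (k : nat) (S : set X) : Prop :=
  (k <= n)%N /\
  forall x, S x -> exists2 c, slice_chart A k S c & chart_dom c x.

(* The charts are the first [k] coordinates of the slice charts; the type of
   elements of [S] carries the topology induced by [X]. *)
Definition submanifold_atlas (R : realType) (n : nat) (X : topologicalType)
    (A : set (chart R n X)) (k : nat) (S : set X) : set (chart R k S) :=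
  [set b | exists c, [/\ slice_chart A k S c,
    chart_dom b = set_val @^-1` chart_dom c &
    forall y : S, chart_dom b y -> forall (i : 'I_k) (j : 'I_n),
      i = j :> nat -> b y 0 i = c (set_val y) 0 j]].

(* No compatibility between the two structures is required here. *)
#[short(type="groupTopologicalType")]
HB.structure Definition GroupTopological := {G of Group G & Topological G}.

Definition lie_group (R : realType) (m : nat) (G : groupTopologicalType)
    (B : set (chart R m G)) : Prop :=
  [/\ smooth_manifold B,
      smooth_map (prod_atlas B B) B (fun p : G * G => (p.1 * p.2)%g) &
      smooth_map B B (fun g : G => (g^-1)%g)].

Definition right_action (X : Type) (G : groupType) (act : X -> G -> X) : Prop :=
  (forall x, act x 1%g = x) /\
  (forall x g h, act x (g * h)%g = act (act x g) h).

Definition free_action (X : Type) (G : groupType) (act : X -> G -> X) : Prop :=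
  forall x g, act x g = x -> g = 1%g.

Definition proper_map (X Y : topologicalType) (f : X -> Y) : Prop :=
  forall K : set Y, compact K -> compact (f @^-1` K).

Definition proper_action (X : topologicalType) (G : groupTopologicalType)
    (act : X -> G -> X) : Prop :=
  proper_map (fun p : X * G => (p.1, act p.1 p.2)).

Definition action_orbit (X : Type) (G : groupType) (act : X -> G -> X) (x : X) :
    set X :=
  range (act x).

(* For a free action and [y] in the orbit of [x], the unique [g] such that
   [y = act x g]; the value is irrelevant when [y] is not in that orbit. *)
Definition translation_map (X : Type) (G : groupType) (act : X -> G -> X)
    (x y : X) : G :=
  xget 1%g [set g | y = act x g].

Definition orbit_translation (X : Type) (G : groupType) (act : X -> G -> X)
    (x : X) (y : action_orbit act x) : G :=
  translation_map act x (set_val y).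

(* Main.v *)
Require Import Defs.
From HB Require Import structures.
From mathcomp Require Import all_boot all_order all_algebra.
From mathcomp Require Import all_classical all_reals all_analysis.
From mathcomp Require Import ring lra.

(* The orbit map [phi g = x . g] is injective because the action is free, and it
   intertwines right translations of G with the diffeomorphisms [y |-> y . h] of
   X, so its rank is constant. An injective map of constant rank is an immersion:
   after a change of coordinates in the source, a map of constant rank r only
   depends on the first r coordinates. Properness makes [phi] a homeomorphism
   onto its image: near a point of X only the group elements in a compact set
   matter. Completing the immersion to a local diffeomorphism of R^n, whose
   inverse exists by the inverse function theorem, yields slice charts of X in
   which [phi] reads u |-> (u, 0); in the induced charts of the orbit, [phi] and
   its inverse, the translation map, are both the identity. *)

Set Implicit Arguments.
Unset Strict Implicit.
Unset Printing Implicit Defensive.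

Import Order.TTheory GRing.Theory Num.Theory numFieldNormedType.Exports.

Local Open Scope classical_set_scope.
Local Open Scope ring_scope.

(** * Calculus of C^k functions on open subsets of R^n *)

(** An injective smooth map need not be an immersion, as t |-> t^3 shows; the symmetry under
    translations is what excludes this. An injective immersion need not be an embedding either, as a
    line winding densely around a torus shows: the orbit could come back arbitrarily close to
    itself, and a chart would then meet it in more than one slice. Properness allows the chart
    domain to be shrunk until these returns are gone. Smoothness is given by iterated partial
    derivatives. The bridge to Jacobian matrices is the strict differentiability of C^1 functions,
    which controls f u - f v for two moving points: it gives the Fréchet derivative, hence the chain
    rule, and the contraction behind the inverse function theorem. The slice charts arise by
    changing coordinates in charts of [A], so they belong to the maximal atlas and not to [A]
    itself. *)

Section ScalarCk.
Context {R : realType} {n : nat}.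
Implicit Types (W : set 'rV[R]_n) (f g : 'rV[R]_n -> R).

(* [Ck_on] for scalar functions, for which products and inverses make sense; the
   two notions are related coordinatewise by [Ck_onP]. *)
Fixpoint scalar_Ck k W f : Prop :=
  (forall u, W u -> {for u, continuous f}) /\
  match k with
  | 0%N => True
  | k'.+1 => forall i : 'I_n,
      (forall u, W u -> derivable f u (delta_mx 0 i)) /\
      scalar_Ck k' W ('D_(delta_mx 0 i) f)
  end.

Lemma scalar_Ck_continuous k W f u :
  scalar_Ck k W f -> W u -> {for u, continuous f}.
Proof. by case: k => [|k] [cf _]; exact: cf. Qed.

Lemma scalar_Ck_sub k W W' f : W' `<=` W -> scalar_Ck k W f -> scalar_Ck k W' f.
Proof.
elim: k f => [|k IH] f sW [cf df]; split=> //.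
- by move=> u /sW/cf.
- by move=> u /sW/cf.
- move=> i; have [dfi Cf] := df i; split; first by move=> u /sW/dfi.
  exact: IH.
Qed.

Lemma open_near_eq W f g u : open W -> {in W, f =1 g} -> W u ->
  \forall v \near u, f v = g v.
Proof.
move=> oW fg Wu; have : nbhs u W by exact: open_nbhs_nbhs.
by apply: filterS => v Wv; apply: fg; rewrite inE.
Qed.

Lemma scalar_Ck_ext k W f g : open W -> {in W, f =1 g} ->
  scalar_Ck k W f -> scalar_Ck k W g.
Proof.
move=> oW; elim: k f g => [|k IH] f g fg [cf df]; split=> //.
- move=> u Wu; rewrite /prop_for /continuous_at -fg ?inE//.
  exact: cvg_trans (near_eq_cvg (open_near_eq oW fg Wu)) (cf u Wu).
- move=> u Wu; rewrite /prop_for /continuous_at -fg ?inE//.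
  exact: cvg_trans (near_eq_cvg (open_near_eq oW fg Wu)) (cf u Wu).
- move=> i; have [dfi Cf] := df i; split.
    by move=> u Wu; apply: near_eq_derivable (dfi u Wu); exact: open_near_eq fg _.
  apply: IH Cf => u /[!inE] Wu; apply: near_eq_derive; exact: open_near_eq fg _.
Qed.

Lemma scalar_CkS k W f : scalar_Ck k.+1 W f -> scalar_Ck k W f.
Proof.
elim: k f => [|k IH] f [cf df]; split=> //.
move=> i; have [dfi Cf] := df i; split=> //; exact: (IH _ Cf).
Qed.

(** The iterated derivatives are those of the total function and do not mention the set, so the
    conditions at a point can be read off in any [W'] containing it. *)
Lemma scalar_Ck_local k W f :
  (forall u, W u -> exists2 W', W' u & scalar_Ck k W' f) -> scalar_Ck k W f.
Proof.
elim: k f => [|k IH] f loc; split=> //.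
- by move=> u Wu; have [W' W'u [cf _]] := loc u Wu; exact: cf.
- by move=> u Wu; have [W' W'u [cf _]] := loc u Wu; exact: cf.
- move=> i; split.
    by move=> u Wu; have [W' W'u [_ /(_ i)[dfi _]]] := loc u Wu; exact: dfi.
  apply: IH => u Wu; have [W' W'u [_ /(_ i)[_ Cf]]] := loc u Wu.
  by exists W'.
Qed.

Lemma scalar_Ck_cst k W (c : R) : scalar_Ck k W (fun=> c).
Proof.
elim: k c => [|k IH] c; split=> //.
- by move=> u _; exact: cst_continuous.
- by move=> u _; exact: cst_continuous.
- move=> i; split; first by move=> u _; exact: derivable_cst.
  suff -> : 'D_(delta_mx 0 i) (fun=> c) = (fun=> 0) :> ('rV[R]_n -> R) by exact: IH.
  by apply/funext => u; rewrite derive_cst.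
Qed.

Lemma scalar_CkD k W f g : open W -> scalar_Ck k W f -> scalar_Ck k W g ->
  scalar_Ck k W (fun u => f u + g u).
Proof.
move=> oW; elim: k f g => [|k IH] f g [cf df] [cg dg]; split=> //.
- by move=> u Wu; exact: (cvgD (cf u Wu) (cg u Wu)).
- by move=> u Wu; exact: (cvgD (cf u Wu) (cg u Wu)).
- move=> i; have [dfi Cf] := df i; have [dgi Cg] := dg i; split.
    by move=> u Wu; apply: derivableD; [exact: dfi|exact: dgi].
  apply: scalar_Ck_ext (IH _ _ Cf Cg) => // u /[!inE] Wu.
  by rewrite -deriveD//; [exact: dfi|exact: dgi].
Qed.

(** Leibniz's rule at order [k.+1] multiplies each derivative by the other function itself, taken at
    order [k]; hence [scalar_CkS]. *)
Lemma scalar_CkM k W f g : open W -> scalar_Ck k W f -> scalar_Ck k W g ->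
  scalar_Ck k W (fun u => f u * g u).
Proof.
move=> oW; elim: k f g => [|k IH] f g Cf0 Cg0.
  by split=> // u Wu; exact: (cvgM (Cf0.1 u Wu) (Cg0.1 u Wu)).
have [cf df] := Cf0; have [cg dg] := Cg0; split.
  by move=> u Wu; exact: (cvgM (cf u Wu) (cg u Wu)).
move=> i; have [dfi Cf] := df i; have [dgi Cg] := dg i; split.
  by move=> u Wu; apply: derivableM; [exact: dfi|exact: dgi].
apply: scalar_Ck_ext (scalar_CkD oW (IH _ _ (scalar_CkS Cf0) Cg)
                                    (IH _ _ (scalar_CkS Cg0) Cf)) => // u /[!inE] Wu.
by rewrite [RHS](deriveM (dfi u Wu) (dgi u Wu)).
Qed.

(** The derivative of the inverse is minus its square times the derivative of [f], and the inverse
    is of class C^k by induction. *)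
Lemma scalar_CkV k W f : open W -> (forall u, W u -> f u != 0) ->
  scalar_Ck k W f -> scalar_Ck k W (fun u => (f u)^-1).
Proof.
move=> oW f0; elim: k => [|k IH] Cf0.
  by split=> // u Wu; exact: (cvgV (f0 u Wu) (Cf0.1 u Wu)).
have [cf df] := Cf0; split.
  by move=> u Wu; exact: (cvgV (f0 u Wu) (cf u Wu)).
move=> i; have [dfi Cf] := df i; split.
  by move=> u Wu; apply: derivableV; [exact: f0|exact: dfi].
have CV := IH (scalar_CkS Cf0).
apply: scalar_Ck_ext (scalar_CkM oW (scalar_Ck_cst _ _ (-1))
  (scalar_CkM oW (scalar_CkM oW CV CV) Cf)) => // u /[!inE] Wu.
rewrite (deriveV (f0 _ Wu) (dfi u Wu)) mulN1r scaleNr /GRing.scale/=.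
by rewrite -exprVn expr2.
Qed.

Lemma scalar_Ck_sum k W (I : Type) (r : seq I) (P : pred I) (F : I -> 'rV[R]_n -> R) :
  open W -> (forall i, P i -> scalar_Ck k W (F i)) ->
  scalar_Ck k W (fun u => \sum_(i <- r | P i) F i u).
Proof.
move=> oW CF; elim: r => [|i r IH].
  by apply: scalar_Ck_ext (scalar_Ck_cst k W 0) => // u _; rewrite big_nil.
have [Pi|Pi] := boolP (P i).
  apply: scalar_Ck_ext (scalar_CkD oW (CF i Pi) IH) => // u _.
  by rewrite big_cons Pi.
by apply: scalar_Ck_ext IH => // u _; rewrite big_cons (negbTE Pi).
Qed.

Lemma scalar_Ck_prod k W (I : Type) (r : seq I) (P : pred I) (F : I -> 'rV[R]_n -> R) :
  open W -> (forall i, P i -> scalar_Ck k W (F i)) ->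
  scalar_Ck k W (fun u => \prod_(i <- r | P i) F i u).
Proof.
move=> oW CF; elim: r => [|i r IH].
  by apply: scalar_Ck_ext (scalar_Ck_cst k W 1) => // u _; rewrite big_nil.
have [Pi|Pi] := boolP (P i).
  apply: scalar_Ck_ext (scalar_CkM oW (CF i Pi) IH) => // u _.
  by rewrite big_cons Pi.
by apply: scalar_Ck_ext IH => // u _; rewrite big_cons (negbTE Pi).
Qed.

Lemma scalar_Ck_coord k W j : scalar_Ck k W (fun u => u 0 j).
Proof.
have dj (u v : 'rV[R]_n) : is_derive u v (fun u : 'rV[R]_n => u 0 j) (v 0 j).
  have /derivable_mxP/(_ 0 j) d : derivable (@id 'rV[R]_n) u v by exact: derivable_id.
  apply: DeriveDef => //.
  have := @derive_mx _ _ _ _ (@id 'rV[R]_n) u v (@derivable_id _ _ _ _).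
  by rewrite derive_id => /matrixP/(_ 0 j); rewrite mxE => <-.
case: k => [|k]; split=> //.
- by move=> u _; exact: coord_continuous.
- by move=> u _; exact: coord_continuous.
- move=> i; split; first by move=> u _; have [] := dj u (delta_mx 0 i).
  suff -> : 'D_(delta_mx 0 i) (fun u : 'rV[R]_n => u 0 j) =
     (fun=> (delta_mx 0 i : 'rV[R]_n) 0 j) by exact: scalar_Ck_cst.
  by apply/funext => u; have [_ <-] := dj u (delta_mx 0 i).
Qed.

End ScalarCk.

(** * Coordinates and norms of vectors and matrices *)

Lemma cvg_mxP (T : Type) (F : set_system T) {FF : Filter F} (K : topologicalType)
    (m n : nat) (f : T -> 'M[K]_(m, n)) (M : 'M[K]_(m, n)) :
  f @ F --> M <-> forall i j, f x i j @[x --> F] --> M i j.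
Proof.
split=> [fM i j A nA|fM A [P nP sP]].
  apply: (fM [set N | A (N i j)]).
  (* This box constrains the entry at [i], [j] only; at any other entry the premises are false and
     every value is allowed. *)
  exists (fun k l => [set a | k = i -> l = j -> A a]) => [k l|N /(_ i j)]; last exact.
  have [-> |ki] := eqVneq k i; last first.
    by apply: filterE => a /= e; rewrite e eqxx in ki.
  have [-> |lj] := eqVneq l j; last first.
    by apply: filterE => a /= _ e; rewrite e eqxx in lj.
  by apply: filterS nA => a Aa _ _.
suff : \forall x \near F, forall i j, P i j (f x i j) by apply: filterS => x /sP.
by apply: filter_forall => i; apply: filter_forall => j; apply: fM; exact: nP.
Qed.

Lemma continuous_mxP (T K : topologicalType) (m n : nat) (f : T -> 'M[K]_(m, n)) (x : T) :
  {for x, continuous f} <-> forall i j, {for x, continuous (fun y => f y i j)}.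
Proof. exact: cvg_mxP. Qed.

Section MatrixNorm.
Context {R : realType} {m n : nat}.
Implicit Types M : 'M[R]_(m, n).

Lemma mx_norm_coord_le M i j : `|M i j| <= `|M|.
Proof. by rewrite [leRHS]/Num.norm/= mx_normrE; exact: (le_bigmax _ _ (i, j)). Qed.

Lemma mx_norm_le M (e : R) : 0 <= e -> (forall i j, `|M i j| <= e) -> `|M| <= e.
Proof.
by move=> e0 Me; rewrite [leLHS]/Num.norm/= mx_normrE; apply: bigmax_le => // -[i j].
Qed.

End MatrixNorm.

(** The norm is the largest absolute value of an entry, and an entry of the product is a sum of [n]
    products. *)
Lemma mx_norm_mul (R : realType) m n p (M : 'M[R]_(m, n)) (N : 'M[R]_(n, p)) :
  `|M *m N| <= `|M| * (`|N| *+ n).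
Proof.
apply: mx_norm_le => [|i j]; first by rewrite mulr_ge0// mulrn_wge0.
rewrite mxE (le_trans (ler_norm_sum _ _ _))//.
rewrite -[X in _ *+ X](card_ord n) -sumr_const mulr_sumr ler_sum// => k _.
by rewrite normrM ler_pM ?mx_norm_coord_le.
Qed.

Section Coordinates.
Context {R : realType} {n m : nat}.
Implicit Types (W : set 'rV[R]_n) (f : 'rV[R]_n -> 'rV[R]_m).

Lemma Ck_onP k W f : open W ->
  Ck_on k W f <-> forall j, scalar_Ck k W (fun u => f u 0 j).
Proof.
move=> oW; elim: k f => [|k IH] f; split.
- by move=> [cf _] j; split=> // u Wu; exact: ((continuous_mxP _ _).1 (cf u Wu)) 0 j.
- move=> cf; split=> // u Wu; apply/continuous_mxP => i j; rewrite (ord1 i).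
  exact: (cf j).1.
- move=> [cf df] j; split=> [u Wu|i].
    exact: ((continuous_mxP _ _).1 (cf u Wu)) 0 j.
  have [dfi Cf] := df i; split=> [u /dfi/derivable_mxP//|].
  have /IH/(_ j) := Cf; apply: scalar_Ck_ext => // u /[!inE] Wu.
  by rewrite derive_mx ?mxE//; exact: dfi.
- move=> Cf.
  have dfi i u : W u -> derivable f u (delta_mx 0 i).
    by move=> Wu; apply/derivable_mxP => a j; rewrite (ord1 a); exact: ((Cf j).2 i).1.
  split=> [u Wu|i].
    by apply/continuous_mxP => i j; rewrite (ord1 i); exact: (Cf j).1.
  split=> [u|]; first exact: dfi.
  apply/IH => j; have := ((Cf j).2 i).2; apply: scalar_Ck_ext => // u /[!inE] Wu.
  by rewrite derive_mx ?mxE//; exact: dfi.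
Qed.

Lemma Ck_on_ext k W f g : open W -> {in W, f =1 g} -> Ck_on k W f -> Ck_on k W g.
Proof.
move=> oW fg /(Ck_onP _ _ oW) Cf; apply/Ck_onP => // j.
by apply: scalar_Ck_ext (Cf j) => // u /fg ->.
Qed.

Lemma Ck_on_continuous k W f u : Ck_on k W f -> W u -> {for u, continuous f}.
Proof. by case: k => [|k] [cf _]; exact: cf. Qed.

Lemma smooth_on_ext W f g : open W -> {in W, f =1 g} -> smooth_on W f -> smooth_on W g.
Proof. by move=> oW fg Cf k; exact: Ck_on_ext (Cf k). Qed.

Lemma smooth_on_sub W W' f : open W -> open W' -> W' `<=` W ->
  smooth_on W f -> smooth_on W' f.
Proof.
move=> oW oW' sW Cf k; apply/Ck_onP => // j.
by apply: scalar_Ck_sub sW _; exact: (Ck_onP _ _ oW).1 (Cf k) j.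
Qed.

Lemma smooth_on_local W f : open W ->
  (forall u, W u -> exists W', [/\ open W', W' u & smooth_on W' f]) -> smooth_on W f.
Proof.
move=> oW loc k; apply/Ck_onP => // j; apply: scalar_Ck_local => u /loc[W' [oW' W'u Cf]].
by exists W' => //; exact: (Ck_onP _ _ oW').1 (Cf k) j.
Qed.

Lemma smooth_on_coord W f : open W ->
  (forall j k, scalar_Ck k W (fun u => f u 0 j)) -> smooth_on W f.
Proof. by move=> oW Cf k; apply/Ck_onP. Qed.

Lemma smooth_on_affine W (M : 'M[R]_(n, m)) (c : 'rV[R]_m) : open W ->
  smooth_on W (fun u => u *m M + c).
Proof.
move=> oW; apply: smooth_on_coord => // j k.
apply: scalar_Ck_ext (scalar_CkD oW (scalar_Ck_sum (index_enum 'I_n) (P := xpredT) oW _)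
  (scalar_Ck_cst _ _ (c 0 j))) => //.
- by move=> u _; rewrite mxE; congr (_ + _); rewrite mxE; exact: erefl.
- move=> i _; apply: scalar_CkM => //; first exact: scalar_Ck_coord.
  exact: scalar_Ck_cst.
Qed.

End Coordinates.

(** * Strict differentiability and the Jacobian matrix *)

Section StrictDifferentiability.
Context {R : realType} {n : nat}.
Implicit Types (W : set 'rV[R]_n).

Lemma is_derive_line (f : 'rV[R]_n -> R) (w v : 'rV[R]_n) (s : R) :
  derivable f (s *: v + w) v ->
  is_derive s 1 (fun t : R => f (t *: v + w)) ('D_v f (s *: v + w)).
Proof.
rewrite /derivable => df.
have E : (fun h => h^-1 *: (((fun t : R => f (t *: v + w)) \o shift s) (h *: 1)
   - f (s *: v + w))) = (fun h => h^-1 *: ((f \o shift (s *: v + w)) (h *: v)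
   - f (s *: v + w))).
  by apply/funext => h /=; rewrite [h *: 1]mulr1 scalerDl addrA.
by apply: DeriveDef; rewrite /derivable /derive E.
Qed.

(** This is the mean value theorem on a line, with [c] a reference slope and [e] the tolerated
    deviation. With [c] and [e] both 0 it says that [f] takes the same value at both ends, the form
    used for maps of constant rank. *)
Lemma line_estimate (f : 'rV[R]_n -> R) (v w : 'rV[R]_n) (a b c e : R) :
  (forall s, Order.min a b <= s <= Order.max a b ->
     derivable f (s *: v + w) v /\ `|'D_v f (s *: v + w) - c| <= e) ->
  `|f (b *: v + w) - f (a *: v + w) - (b - a) * c| <= e * `|b - a|.
Proof.
wlog ab : a b / a <= b.
  move=> H; have /orP[|ba ab] := le_total a b; first exact: H.
  have := H b a ba; rewrite minC maxC => /(_ ab) Hba; rewrite [`|b - a|]distrC.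
  rewrite (_ : _ - _ = - (f (a *: v + w) - f (b *: v + w) - (a - b) * c)) ?normrN//.
  by ring.
rewrite min_l// max_r// => H.
have dpsi s : s \in `[a, b] ->
    is_derive s 1 (fun t : R => f (t *: v + w)) ('D_v f (s *: v + w)).
  by rewrite in_itv/= => /H[] + _; exact: is_derive_line.
have cpsi : {within `[a, b], continuous (fun t : R => f (t *: v + w))}.
  by apply: derivable_within_continuous => s /dpsi[].
have [s sab /= ->] := MVT_segment ab (fun s sab => dpsi s (subset_itv_oo_cc sab)) cpsi.
rewrite mulrC -mulrBr normrM mulrC ler_wpM2r//.
by have [] := H s; rewrite -?in_itv.
Qed.

(* [v] is moved to [u] one coordinate at a time; as balls are boxes for the sup
   norm, the intermediate points stay in the ball. *)
Lemma strict_derivative (f : 'rV[R]_n -> R) W p (e : R) :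
  open W -> scalar_Ck 1 W f -> W p -> 0 < e ->
  exists2 r : R, 0 < r & forall u v, ball p r u -> ball p r v ->
    `|f u - f v - \sum_j (u - v) 0 j * 'D_(delta_mx 0 j) f p| <= e * `|u - v|.
Proof.
move=> oW [_ df] Wp e0.
(* There are [n] steps, each contributing at most [e']; dividing by [n.+1] also covers dimension
   0. *)
pose e' := e / n.+1%:R.
have e'0 : 0 < e' by rewrite divr_gt0.
have : \forall u \near p, W u /\
   forall j, `|'D_(delta_mx 0 j) f p - 'D_(delta_mx 0 j) f u| <= e'.
  near=> u; split; first by near: u; exact: open_nbhs_nbhs.
  near: u; apply: filter_forall => j.
  by have [_ [cD _]] := df j; move/cvgrPdist_le: (cD p Wp); exact.
move=> /nbhs_ballP[r/= r0 pr]; exists r => // u v pu pv.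
pose z k : 'rV[R]_n := \row_j if (j < k)%N then u 0 j else v 0 j.
have -> : f u - f v = \sum_(k < n) (f (z k.+1) - f (z k)).
  rewrite -(big_mkord xpredT (fun k => f (z k.+1) - f (z k))) telescope_sumr//.
  by congr (f _ - f _); apply/rowP => j; rewrite mxE// ltn_ord.
rewrite -sumrB (le_trans (ler_norm_sum _ _ _))//.
apply: (@le_trans _ _ (\sum_(k < n) e' * `|u - v|)); last first.
  rewrite sumr_const card_ord -mulrnAl ler_wpM2r// /e' -mulr_natr -mulrA ler_piMr ?ltW//.
  by rewrite mulrC ltr_pdivrMr// mul1r ltr_nat.
apply: ler_sum => k _.
(* [z k] and [z k.+1] differ only in the coordinate [k]; [w] is their common part. *)
pose w : 'rV[R]_n := \row_j if j == k then 0 else if (j < k)%N then u 0 j else v 0 j.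
have -> : z k.+1 = u 0 k *: delta_mx 0 k + w.
  apply/rowP => j; rewrite !mxE/= ltnS leq_eqVlt -val_eqE/=.
  by case: (eqVneq (j : nat) k) => [/val_inj ->|]/=; rewrite ?mulr1 ?mulr0 ?addr0 ?add0r.
have -> : z k = v 0 k *: delta_mx 0 k + w.
  apply/rowP => j; rewrite !mxE/= -val_eqE/=.
  case: (eqVneq (j : nat) k) => [/val_inj ->|]/=; last by rewrite mulr0 add0r.
  by rewrite mulr1 addr0 ltnn.
rewrite !mxE.
apply: (@le_trans _ _ (e' * `|u 0 k - v 0 k|)); last first.
  rewrite (ler_wpM2l (ltW e'0))//.
  by have := mx_norm_coord_le (u - v) 0 k; rewrite !mxE.
apply: line_estimate => s sab.
have [|Ws Ds] := pr (s *: delta_mx 0 k + w); last first.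
  by split; [have [+ _] := df k; exact|rewrite distrC].
split=> // i j; rewrite (ord1 i) !mxE/= -ball_normE/=.
have [_ /(_ 0 j)] := pu; have [_ /(_ 0 j)] := pv; rewrite -!ball_normE/=.
case: (eqVneq j k) => [->|] pvj puj; last first.
  by rewrite mulr0 add0r; case: ifP.
rewrite mulr1 addr0; move: pvj puj sab; rewrite !ltr_distlC => /andP[? ?] /andP[? ?] /andP[].
rewrite ge_min le_max => /orP[] ? /orP[] ?; lra.
Unshelve. all: by end_near. Qed.

End StrictDifferentiability.

Section Jacobian.
Context {R : realType} {n m : nat}.
Implicit Types (W : set 'rV[R]_n) (f : 'rV[R]_n -> 'rV[R]_m).

Lemma mulmxr_continuous (M : 'M[R]_(n, m)) : continuous (mulmxr M : 'rV[R]_n -> 'rV[R]_m).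
Proof.
move=> u; have Cf := @smooth_on_affine R n m setT M 0 openT.
have -> : (mulmxr M : 'rV[R]_n -> 'rV[R]_m) = (fun u => u *m M + 0).
  by apply/funext => v /=; rewrite addr0.
exact: (Ck_on_continuous (Cf 0%N)).
Qed.

Lemma strict_derivative_mx W f p (e : R) :
  open W -> Ck_on 1 W f -> W p -> 0 < e ->
  exists2 r : R, 0 < r & forall u v, ball p r u -> ball p r v ->
    `|f u - f v - (u - v) *m (\matrix_i 'D_(delta_mx 0 i) f p)| <= e * `|u - v|.
Proof.
move=> oW Cf Wp e0.
have dfi i : derivable f p (delta_mx 0 i) by exact: (Cf.2 i).1.
pose estimate (r : R) j := forall u v, ball p r u -> ball p r v ->
  `|f u 0 j - f v 0 j
    - \sum_i (u - v) 0 i * 'D_(delta_mx 0 i) (fun u => f u 0 j) p| <= e * `|u - v|.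
(* Stating the estimates near 0 lets finitely many of them be intersected, so that one radius serves
   all coordinates. *)
have H : \forall r \near 0^'+, forall j, estimate r j.
  apply: filter_forall => j.
  have [r r0 rj] := strict_derivative oW ((Ck_onP _ _ oW).1 Cf j) Wp e0.
  near=> s => u v pu pv.
  have sr : s <= r by near: s; exact: nbhs_right_le.
  by apply: rj; exact: le_ball sr _ _.
near (0 : R)^'+ => r; exists r => // u v pu pv.
apply: mx_norm_le => [|i j]; first by rewrite mulr_ge0// ltW.
rewrite (ord1 i) !mxE.
under eq_bigr => k _ do rewrite [X in _ * X]mxE derive_mx// [X in _ * X]mxE.
have rj : forall j, estimate r j by near: r.
exact: rj.
Unshelve. all: by end_near. Qed.

(** The strict estimate with one of the two points fixed at [p] is the Fréchet expansion at [p],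
    with the matrix of partial derivatives. *)
Lemma C1_differentiable W f p : open W -> Ck_on 1 W f -> W p -> differentiable f p.
Proof.
move=> oW Cf Wp; pose M := \matrix_i 'D_(delta_mx 0 i) f p.
have d : f \o shift p = cst (f p) + (mulmxr M : {linear _ -> _}) +o_ (0 : 'rV[R]_n) id.
  apply/eqaddoP => e e0.
  have [r r0 H] := strict_derivative_mx oW Cf Wp e0.
  near=> h.
  have -> : (f \o shift p - (cst (f p) + (mulmxr M : 'rV[R]_n -> 'rV[R]_m))) h
     = f (h + p) - f p - (h + p - p) *m M.
    by rewrite /= !fctE/= addrK opprD addrA.
  apply: le_trans (H (h + p) p _ (ballxx _ r0)) _; last by rewrite addrK.
  rewrite -ball_normE/= opprD addrCA subrr addr0 normrN; near: h.
  exact: (@nbhs0_lt R 'rV[R]_n).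
apply/diff_locallyP; rewrite (diff_unique (mulmxr_continuous (M := M)) d).
by split=> //; exact: mulmxr_continuous.
Unshelve. all: by end_near. Qed.

Lemma jacobianE W f p i j : open W -> Ck_on 1 W f -> W p ->
  'J f p i j = 'D_(delta_mx 0 i) f p 0 j.
Proof.
move=> oW Cf Wp; rewrite (deriveEjacobian _ (C1_differentiable oW Cf Wp)).
by rewrite -rowE [RHS]mxE.
Qed.

Lemma strict_jacobian W f p (e : R) :
  open W -> Ck_on 1 W f -> W p -> 0 < e ->
  exists2 r : R, 0 < r & forall u v, ball p r u -> ball p r v ->
    `|f u - f v - (u - v) *m 'J f p| <= e * `|u - v|.
Proof.
move=> oW Cf Wp e0.
have -> : 'J f p = \matrix_i 'D_(delta_mx 0 i) f p.
  by apply/matrixP => i j; rewrite (jacobianE _ _ oW Cf Wp) mxE.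
exact: strict_derivative_mx Cf Wp e0.
Qed.

End Jacobian.

Lemma Ck_on_C1 (R : realType) n m k (W : set 'rV[R]_n) (f : 'rV[R]_n -> 'rV[R]_m) :
  Ck_on k.+1 W f -> Ck_on 1 W f.
Proof.
move=> [cf df]; split=> // i; have [dfi Cf] := df i; split=> //; split=> // u Wu.
exact: Ck_on_continuous Cf Wu.
Qed.

(** * The chain rule *)

Section Composition.
Context {R : realType} {n m p : nat}.
Implicit Types (f : 'rV[R]_n -> 'rV[R]_m) (g : 'rV[R]_m -> 'rV[R]_p).

Lemma jacobian_comp f g u : differentiable f u -> differentiable g (f u) ->
  'J (g \o f) u = 'J f u *m 'J g (f u).
Proof.
move=> df dg; apply/row_matrixP => i.
rewrite row_mul !rowE /jacobian !mul_rV_lin1.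
by rewrite (diff_comp df dg).
Qed.

(** Induction on [k]: a partial derivative of [g \o f] is a sum of products of a partial derivative
    of [f] and a partial derivative of [g] composed with [f], and the induction hypothesis applies
    to the latter. *)
Lemma Ck_on_comp k W V f g : open W -> open V -> f @` W `<=` V ->
  Ck_on k W f -> Ck_on k V g -> Ck_on k W (g \o f).
Proof.
move=> oW oV WV; have Vf u : W u -> V (f u) by move=> Wu; apply: WV; exists u.
elim: k g => [|k IH] g Cf Cg.
  split=> // u Wu; apply: continuous_comp; first exact: Cf.1.
  exact: Cg.1 _ (Vf _ Wu).
have df u : W u -> differentiable f u.
  by move=> Wu; exact: C1_differentiable oW (Ck_on_C1 Cf) Wu.
have dg u : W u -> differentiable g (f u).
  by move=> Wu; exact: C1_differentiable oV (Ck_on_C1 Cg) (Vf _ Wu).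
split=> [u Wu|i].
  apply: continuous_comp; first exact: Cf.1.
  exact: Cg.1 _ (Vf _ Wu).
split=> [u Wu|].
  by apply: diff_derivable; apply: differentiable_comp; [exact: df|exact: dg].
apply/Ck_onP => // l.
have Cfk : Ck_on k W f.
  by apply/Ck_onP => // j; apply: scalar_CkS; exact: (Ck_onP _ _ oW).1.
have CD (j : 'I_m) : scalar_Ck k W
    (fun u => 'D_(delta_mx 0 i) f u 0 j * ('D_(delta_mx 0 j) g \o f) u 0 l).
  apply: scalar_CkM => //; first exact: (Ck_onP _ _ oW).1 (Cf.2 i).2 j.
  have /(Ck_onP _ _ oW)/(_ l) := IH _ Cfk (Cg.2 j).2; exact.
apply: scalar_Ck_ext
  (scalar_Ck_sum (index_enum 'I_m) (P := xpredT) oW (fun j _ => CD j)) => //.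
move=> u /[!inE] Wu; rewrite [in RHS]deriveEjacobian; last first.
  by apply: differentiable_comp; [exact: df|exact: dg].
rewrite (jacobian_comp (df _ Wu) (dg _ Wu)) mulmxA -(deriveEjacobian _ (df _ Wu)) mxE.
apply: eq_bigr => j _; congr (_ * _).
by rewrite /= (deriveEjacobian _ (dg _ Wu)) -rowE [LHS]mxE.
Qed.

Lemma smooth_on_comp W V f g : open W -> open V -> f @` W `<=` V ->
  smooth_on W f -> smooth_on V g -> smooth_on W (g \o f).
Proof. by move=> oW oV sWV Cf Cg k; exact: Ck_on_comp (Cf k) (Cg k). Qed.

End Composition.

(** * The inverse function theorem *)

HB.instance Definition _ (R : realType) (n : nat) := Complete.on 'rV[R]_n.

Section MatrixCk.
Context {R : realType} {n : nat}.
Variables (W : set 'rV[R]_n) (oW : open W).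

Lemma scalar_Ck_det k q (M : 'rV[R]_n -> 'M[R]_q) :
  (forall i j, scalar_Ck k W (fun u => M u i j)) ->
  scalar_Ck k W (fun u => \det (M u)).
Proof.
move=> CM; apply: scalar_Ck_sum => // s _; apply: scalar_CkM => //.
  exact: scalar_Ck_cst.
by apply: scalar_Ck_prod => // i _; exact: CM.
Qed.

(** By Cramer's rule the entries of the inverse are cofactors divided by the determinant. *)
Lemma scalar_Ck_invmx k q (M : 'rV[R]_n -> 'M[R]_q) :
  (forall u, W u -> M u \in unitmx) ->
  (forall i j, scalar_Ck k W (fun u => M u i j)) ->
  forall i j, scalar_Ck k W (fun u => invmx (M u) i j).
Proof.
move=> Mu CM i j.
apply: (@scalar_Ck_ext _ _ _ _ (fun u => (\det (M u))^-1 *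
   ((-1) ^+ (j + i) * \det (row' j (col' i (M u)))))) => //.
  by move=> u /[!inE] Wu; rewrite /invmx Mu// !mxE.
apply: scalar_CkM => //.
  apply: scalar_CkV => //; last exact: scalar_Ck_det.
  by move=> u /Mu; rewrite unitmxE unitfE.
apply: scalar_CkM => //; first exact: scalar_Ck_cst.
apply: scalar_Ck_det => a b.
by apply: scalar_Ck_ext (CM (lift j a) (lift i b)) => // u _; rewrite !mxE.
Qed.

End MatrixCk.

Section InverseFunction.
Context {R : realType} {n : nat}.
Variables (f : 'rV[R]_n -> 'rV[R]_n) (W : set 'rV[R]_n) (p : 'rV[R]_n).
Hypotheses (oW : open W) (smf : smooth_on W f) (Wp : W p).
Hypothesis Jp_unit : 'J f p \in unitmx.

Lemma jacobian_scalar_Ck k i j : scalar_Ck k W (fun u => 'J f u i j).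
Proof.
have := (Ck_onP _ _ oW).1 ((smf k.+1).2 i).2 j; apply: scalar_Ck_ext => // u /[!inE] Wu.
by rewrite (jacobianE _ _ oW (smf 1) Wu).
Qed.

Lemma jacobian_unit_near : \forall u \near p, W u /\ 'J f u \in unitmx.
Proof.
near=> u; split; first by near: u; exact: open_nbhs_nbhs.
rewrite unitmxE unitfE; near: u.
have /(_ _ Wp) cdet : forall u, W u -> {for u, continuous (fun u => \det ('J f u))}.
  move=> u; apply: (@scalar_Ck_continuous _ _ 0).
  by apply: scalar_Ck_det => // i j; exact: jacobian_scalar_Ck.
by apply: (cvgr_neq0 _ cdet); rewrite -unitfE -unitmxE.
Unshelve. all: by end_near. Qed.

Let A := invmx ('J f p).
(** A bound for multiplication by [A]; the summand 1 makes it positive. *)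
Let K := `|A| *+ n + 1.

Let K0 : 0 < K.
Proof. by rewrite ltr_pwDr// mulrn_wge0. Qed.

Let mulA_le (h : 'rV[R]_n) : `|h *m A| <= K * `|h|.
Proof.
rewrite (le_trans (mx_norm_mul _ _))// mulrC ler_wpM2r// /K lerDl//.
Qed.

(** Followed by [A], [f] differs from the identity by a map with Lipschitz constant 1/2. This bounds
    differences of [f] from below, whence injectivity, and provides the contraction for
    surjectivity. *)
Lemma local_expansion : exists2 r : R, 0 < r & ball p r `<=` W /\
  [/\ forall u, ball p r u -> 'J f u \in unitmx,
      forall u v, ball p r u -> ball p r v ->
        `|(f u - f v) *m A - (u - v)| <= 2^-1 * `|u - v| &
      forall u v, ball p r u -> ball p r v -> `|u - v| <= 2 * K * `|f u - f v|].
Proof.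
(* Multiplication by [A] enlarges the error by a factor of at most [K], which leaves 1/2. *)
have e0 : 0 < (2 * K)^-1 by rewrite invr_gt0 mulr_gt0.
have [r1 r10 H1] := strict_jacobian oW (smf 1) Wp e0.
have /nbhs_ballP[r2/= r20 H2] := jacobian_unit_near.
pose r := Num.min r1 r2.
have b1 u : ball p r u -> ball p r1 u by apply: le_ball; rewrite ge_min lexx.
have b2 u : ball p r u -> ball p r2 u by apply: le_ball; rewrite ge_min lexx orbT.
exists r; first by rewrite lt_min r10.
split; first by move=> u /b2/H2[].
have E u v : ball p r u -> ball p r v ->
    `|(f u - f v) *m A - (u - v)| <= 2^-1 * `|u - v|.
  move=> /b1 pu /b1 pv; rewrite -{1}[u - v](mulmxK Jp_unit) -mulmxBl.
  rewrite (le_trans (mulA_le _))// (le_trans (ler_wpM2l (ltW K0) (H1 _ _ pu pv)))//.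
  by rewrite mulrA invfM mulrCA divff ?gt_eqF// mulr1.
split; [by move=> u /b2/H2[]|exact: E|].
move=> u v pu pv; have Euv := E u v pu pv.
have := lerB_dist (u - v) ((f u - f v) *m A); rewrite distrC => /le_trans/(_ Euv).
have := mulA_le (f u - f v); lra.
Qed.

(* A preimage of [y] is a fixed point of the contraction
   [u |-> u - (f u - y) *m A]. *)
Lemma local_surjectivity r u0 y :
  (forall u v, ball p r u -> ball p r v ->
        `|(f u - f v) *m A - (u - v)| <= 2^-1 * `|u - v|) ->
  forall s, 0 < s -> closed_ball_ Num.norm u0 s `<=` ball p r ->
  `|y - f u0| <= s / (2 * K) -> exists2 u, ball p r u & f u = y.
Proof.
move=> E s s0 sr ys.
pose phi u := u - (f u - y) *m A.
pose C : set 'rV[R]_n := closed_ball_ Num.norm u0 s.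
have Cu0 : C u0 by rewrite /C/closed_ball_/= subrr normr0 ltW.
have phiB u v : C u -> C v -> `|phi u - phi v| <= 2^-1 * `|u - v|.
  move=> /sr Cu /sr Cv; rewrite (le_trans _ (E u v Cu Cv))// -normrN.
  rewrite /phi !opprB !mulmxBl le_eqVlt; apply/orP; left; apply/eqP; congr `|_|.
  by apply/rowP => j; rewrite !mxE; ring.
(* [phi] moves the centre [u0] by at most [s / 2], by the bound on [y - f u0], and it halves
   distances; so it preserves the closed ball of radius [s]. *)
have phiC : {homo phi : u / C u >-> C u}.
  move=> u Cu; rewrite /C/closed_ball_/=.
  have h1 := phiB _ _ Cu0 Cu.
  have h2 : `|u0 - phi u0| <= s / 2.
    rewrite /phi opprB addrC subrK (le_trans (mulA_le _))// distrC.
    rewrite (le_trans (ler_wpM2l (ltW K0) ys))//.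
    by rewrite invfM mulrCA [K * _]mulrC divfK ?gt_eqF.
  have h3 := ler_distD (phi u0) u0 (phi u).
  have : `|u0 - u| <= s by [].
  move: h1 h2 h3; lra.
pose F : {fun C >-> C} := mkfun_fun phiC.
have ctr : is_contraction F.
  exists (2^-1)%:nng; split=> /=; first by lra.
  by move=> [u v] [/= Cu Cv]; exact: phiB.
have clC : closed C by exact: closed_closed_ball_.
have [u Cu uF] := banach_fixed_point ctr clC (ex_intro _ u0 Cu0).
exists u; first exact: sr.
apply/eqP; rewrite -subr_eq0; apply/eqP.
have : u = u - (f u - y) *m A by exact: uF.
move=> /(congr1 (fun w => w - u)); rewrite subrr addrAC subrr add0r.
move=> /(congr1 (fun w => - w *m 'J f p)); rewrite opprK mulmxKV//.
by rewrite oppr0 mul0mx => <-.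
Qed.

(** The Lipschitz bound gives injectivity and the continuity of [g], the contraction gives the
    openness of the image. The derivative of [g] at [y] is the inverse of the Jacobian of [f] at
    [g y]: it involves [g] undifferentiated, so the regularity of [g] climbs one order at a time. *)
Theorem inverse_function : exists U g,
  [/\ open U, U p & U `<=` W] /\
  [/\ {in U, cancel f g}, open (f @` U) & smooth_on (f @` U) g].
Proof.
have [r r0 [rW [Ju E L]]] := local_expansion.
pose U : set 'rV[R]_n := ball p r.
have oU : open U by exact: ball_open.
pose g y := xget p [set u | U u /\ f u = y].
have fU_inj (u v : 'rV[R]_n) : U u -> U v -> f u = f v -> u = v.
  move=> Uu Uv fuv; apply/eqP; rewrite -subr_eq0 -normr_le0.
  by rewrite (le_trans (L u v Uu Uv))// fuv subrr normr0 mulr0.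
have gK : {in U, cancel f g}.
  move=> u /[!inE] Uu; rewrite /g; case: xgetP => [v -> [Uv /fU_inj]|/(_ u)[]]; first exact.
  by [].
have gP y : (f @` U) y -> U (g y) /\ f (g y) = y.
  by move=> [u Uu <-]; rewrite gK ?inE.
have oV : open (f @` U).
  rewrite openE => _ [u0 Uu0 <-].
  have /nbhs_ballP[s/= s0 sU] : nbhs u0 U by exact: open_nbhs_nbhs.
  have s20 : 0 < s / 2 by rewrite divr_gt0.
  (* The contraction lives on a closed ball, which has to fit into the open ball of radius [s]:
     hence [s / 2]. *)
  apply/nbhs_ballP; exists (s / 2 / (2 * K)) => /=.
    by rewrite divr_gt0// mulr_gt0.
  move=> y; rewrite -ball_normE/= distrC => /ltW yu.
  have [v|u Uu <-] := local_surjectivity E s20 _ yu; last by exists u.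
  rewrite /closed_ball_/= => vu; apply: sU; rewrite -ball_normE/=.
  by rewrite (le_lt_trans vu)// ltr_pdivrMr// ltr_pMr// ltr1n.
have cg (y : 'rV[R]_n) : (f @` U) y -> {for y, continuous g}.
  move=> Vy; have FF : Filter (nbhs y) by exact: nbhs_filter.
  apply/cvgrPdist_le => e e0; near=> z.
  have Vz : (f @` U) z by near: z; exact: (open_nbhs_nbhs (conj oV Vy)).
  have [Uz fz] := gP _ Vz; have [Uy fy] := gP _ Vy.
  rewrite (le_trans (L _ _ Uy Uz))// fz fy -ler_pdivlMl ?mulr_gt0//.
  near: z; apply: (@cvgr_dist_le _ _ _ (nbhs y) _ id y) => //.
  by rewrite mulr_gt0// invr_gt0 mulr_gt0.
have dg (y : 'rV[R]_n) i : (f @` U) y ->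
    is_derive y (delta_mx 0 i) g (delta_mx 0 i *m invmx ('J f (g y))).
  move=> Vy; have [Uy fy] := gP _ Vy.
  set e_i := delta_mx 0 i : 'rV[R]_n; set B := invmx _.
  have dgy : h^-1 *: ((g \o shift y) (h *: e_i) - g y) @[h --> 0^'] --> e_i *m B.
    apply/cvgrPdist_le => e e0.
    (* [2 * K] is a Lipschitz constant for [g], and the other factor bounds multiplication by [B]; a
       remainder of [f] of relative size [e / M] thus gives an error of at most [e] in the
       difference quotient of [g]. *)
    pose M := (`|B| *+ n + 1) * (2 * K).
    have B0 : 0 < `|B| *+ n + 1 by apply: ltr_pwDr => //; exact: mulrn_wge0.
    have K20 : 0 < 2 * K by exact: mulr_gt0.
    have M0 : 0 < M by exact: mulr_gt0.
    have eM0 : 0 < e / M by rewrite divr_gt0.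
    have [s s0 Hs] := strict_jacobian oW (smf 1) (rW _ Uy) eM0.
    have near0 (P : set 'rV[R]_n) : nbhs y P -> \forall h \near 0^', P (h *: e_i + y).
      move=> yP; apply: nbhs_dnbhs.
      have : (fun h : R => h *: e_i + y) @ 0 --> (0 : R) *: e_i + y.
        apply: cvgD; last exact: cvg_cst.
        by apply: cvgZr_tmp; exact: cvg_id.
      by rewrite scale0r add0r; apply.
    near=> h.
    have h0 : h != 0 by near: h; exact: nbhs_dnbhs_neq.
    set z := h *: e_i + y.
    have Vz : (f @` U) z.
      rewrite /z; near: h; apply: (near0 (f @` U)).
      exact: (open_nbhs_nbhs (conj oV Vy)).
    have [Uz fz] := gP _ Vz.
    have sz : ball (g y) s (g z).
      rewrite /z; near: h; apply: (near0 (fun z => ball (g y) s (g z))).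
      by apply: (cg y Vy); exact: nbhsx_ballx.
    have Ez := Hs _ _ sz (ballxx _ s0).
    have zy : z - y = h *: e_i by rewrite /z addrK.
    rewrite fz fy zy in Ez.
    have Lz := L _ _ Uz Uy; rewrite fz fy zy normrZ in Lz.
    have ei1 : `|e_i| <= 1.
      by apply: mx_norm_le => // a b; rewrite mxE; case: (_ && _); rewrite ?normr1 ?normr0.
    (* Since [f] sends [g z] and [g y] to [z] and [y], the error is the remainder of [f] at [g y],
       multiplied by [B] and divided by [h]. *)
    have -> : e_i *m B - h^-1 *: ((g \o shift y) (h *: e_i) - g y)
        = h^-1 *: ((h *: e_i - (g z - g y) *m 'J f (g y)) *m B).
      rewrite mulmxBl -mulmxA mulmxV ?Ju// mulmx1.
      by rewrite [RHS]scalerBr -scalemxAl scalerA mulVf// scale1r.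
    have hh : 0 < `|h| by rewrite normr_gt0.
    rewrite normrZ normfV (ler_pdivrMl _ _ hh).
    apply: (le_trans (mx_norm_mul _ _)).
    apply: (@le_trans _ _ ((e / M * (2 * K * `|h|)) * (`|B| *+ n + 1))).
      apply: ler_pM; [exact: normr_ge0|exact: mulrn_wge0| |by rewrite lerDl].
      apply: (le_trans Ez); rewrite ler_wpM2l ?(ltW eM0)// (le_trans Lz)// ler_wpM2l//.
        exact: ltW.
      by rewrite ler_piMr.
    rewrite le_eqVlt; apply/orP; left; apply/eqP; rewrite /M.
    move: (_ + 1) B0 => b b0; move: K K0 => c c0; field.
    by rewrite (gt_eqF c0) (gt_eqF b0).
  by apply: DeriveDef; [apply/cvg_ex; exists (e_i *m B)|exact: cvg_lim].
exists U, g; split; [split=> //; exact: ballxx|split=> //].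
elim=> [|k IH]; first by split.
split=> // i; split=> [y Vy|]; first by have [] := dg y i Vy.
apply/Ck_onP => // j.
apply: (@scalar_Ck_ext _ _ _ _ (fun y => invmx ('J f (g y)) i j)) => //.
  by move=> y /[!inE] Vy; have [_ ->] := dg y i Vy; rewrite -rowE mxE.
apply: (scalar_Ck_invmx oV) => [y Vy|a b].
  by apply: Ju; have [] := gP _ Vy.
(* An entry of the Jacobian is wrapped as a vector of length 1, to which the composition lemma
   applies. *)
pose Jab (u : 'rV[R]_n) : 'rV[R]_1 := \row_(l < 1) 'J f u a b.
have CJ : Ck_on k U Jab.
  apply/Ck_onP => // l; apply: (@scalar_Ck_ext _ _ _ _ (fun u => 'J f u a b)) => //.
    by move=> u _; rewrite [RHS]mxE.
  exact: scalar_Ck_sub rW (jacobian_scalar_Ck _ _ _).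
have /(Ck_onP _ _ oV)/(_ 0) : Ck_on k (f @` U) (Jab \o g).
  by apply: Ck_on_comp CJ => // _ [y Vy <-]; have [] := gP _ Vy.
by apply: scalar_Ck_ext => // y _; rewrite [LHS]mxE.
Unshelve. all: by end_near. Qed.

End InverseFunction.

(** * Maps of constant rank and immersions *)

Lemma row_jacobian (R : realType) n m (f : 'rV[R]_n -> 'rV[R]_m) u i :
  row i ('J f u) = 'd f u (delta_mx 0 i).
Proof. by rewrite rowE /jacobian mul_rV_lin1. Qed.

#[local] Opaque jacobian diff derive.

(** * Rules for Jacobian matrices *)

Section JacobianRules.
Context {R : realType} {n m : nat}.
Implicit Types (f g : 'rV[R]_n -> 'rV[R]_m) (u : 'rV[R]_n).

Lemma differentiable_mulmxr (C : 'M[R]_(n, m)) u :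
  differentiable (mulmxr C : 'rV[R]_n -> 'rV[R]_m) u.
Proof. by apply: linear_differentiable; exact: mulmxr_continuous. Qed.

Lemma jacobian_mulmxr (C : 'M[R]_(n, m)) u : 'J (mulmxr C) u = C.
Proof.
apply/row_matrixP => i; rewrite row_jacobian rowE diff_lin//.
exact: mulmxr_continuous.
Qed.

Lemma jacobianD f g u : differentiable f u -> differentiable g u ->
  'J (f + g) u = 'J f u + 'J g u.
Proof.
move=> df dg; have := diffD df dg; move: (f + g) => h dh.
apply/row_matrixP => i; rewrite [RHS]rowE mulmxDr.
rewrite -[X in _ = X + _]rowE -[X in _ = _ + X]rowE [LHS]row_jacobian.
rewrite [X in _ = X + _]row_jacobian [X in _ = _ + X]row_jacobian.
exact: (congr1 (@^~ (delta_mx 0 i)) dh).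
Qed.

Lemma jacobian_near_eq f g u : differentiable f u -> differentiable g u ->
  (\near u, f u = g u) -> 'J f u = 'J g u.
Proof.
move=> df dg fg; apply/row_matrixP => i.
rewrite [LHS]row_jacobian [RHS]row_jacobian -[LHS]deriveE// -[RHS]deriveE//.
exact: near_eq_derive.
Qed.

End JacobianRules.

(** A map completed by a linear term: both applications of the inverse function theorem concern maps
    of this shape. *)
Lemma jacobian_add_linear (R : realType) n m p (f : 'rV[R]_n -> 'rV[R]_m)
    (C : 'M[R]_(m, p)) (D : 'M[R]_(n, p)) u : differentiable f u ->
  'J (fun v => f v *m C + v *m D) u = 'J f u *m C + D.
Proof.
move=> df; have dC := differentiable_mulmxr C (f u).
have dD := differentiable_mulmxr D u.
rewrite -[in RHS](jacobian_mulmxr C (f u)) -[in RHS](jacobian_mulmxr D u).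
rewrite -jacobian_comp// -jacobianD//.
exact: differentiable_comp.
Qed.

Section SmoothLinear.
Context {R : realType} {n m : nat} (W : set 'rV[R]_n) (oW : open W).

Lemma smooth_onD (f g : 'rV[R]_n -> 'rV[R]_m) :
  smooth_on W f -> smooth_on W g -> smooth_on W (fun u => f u + g u).
Proof.
move=> Cf Cg k; apply/Ck_onP => // j.
have := scalar_CkD oW ((Ck_onP _ _ oW).1 (Cf k) j) ((Ck_onP _ _ oW).1 (Cg k) j).
by apply: scalar_Ck_ext => // u _; rewrite mxE.
Qed.

Lemma smooth_on_mulmx p (f : 'rV[R]_n -> 'rV[R]_m) (C : 'M[R]_(m, p)) :
  smooth_on W f -> smooth_on W (fun u => f u *m C).
Proof.
move=> Cf k; apply/Ck_onP => // j.
have := scalar_Ck_sum (index_enum 'I_m) (P := xpredT) oW (fun i _ =>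
  scalar_CkM oW ((Ck_onP _ _ oW).1 (Cf k) i) (scalar_Ck_cst k W (C i j))).
by apply: scalar_Ck_ext => // u _; rewrite mxE.
Qed.

Lemma smooth_on_linear (C : 'M[R]_(n, m)) : smooth_on W (fun u => u *m C).
Proof.
by apply: smooth_on_ext (smooth_on_affine C 0 oW) => // u _; rewrite addr0.
Qed.

Lemma smooth_on_differentiable (f : 'rV[R]_n -> 'rV[R]_m) u :
  smooth_on W f -> W u -> differentiable f u.
Proof. by move=> Cf Wu; exact: C1_differentiable (Cf 1) Wu. Qed.

End SmoothLinear.

(** * Truncation and zero-padding of coordinates by [pid_mx] *)

Section PidCoordinates.
Context {R : realType} {k n : nat} (kn : (k <= n)%N).

Lemma mul_pid_narrow (u : 'rV[R]_n) i :
  (u *m (pid_mx k : 'M[R]_(n, k))) 0 i = u 0 (widen_ord kn i).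
Proof.
rewrite mxE (bigD1 (widen_ord kn i))//= big1 ?addr0 => [|j ji].
  by rewrite mxE/= eqxx ltn_ord mulr1.
rewrite mxE; case: eqP => [e|]; last by rewrite mulr0.
by case/eqP: ji; exact: val_inj.
Qed.

Lemma mul_pid_wide (u : 'rV[R]_k) (i : 'I_k) (j : 'I_n) : i = j :> nat ->
  (u *m (pid_mx k : 'M[R]_(k, n))) 0 j = u 0 i.
Proof.
move=> ij; rewrite mxE (bigD1 i)//= big1 ?addr0 => [|l li].
  by rewrite mxE/= ij eqxx -ij ltn_ord mulr1.
rewrite mxE; case: eqP => [e|]; last by rewrite mulr0.
by case/eqP: li; apply: val_inj; rewrite /= e.
Qed.

Lemma mul_pid_wide0 (u : 'rV[R]_k) (j : 'I_n) : (k <= j)%N ->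
  (u *m (pid_mx k : 'M[R]_(k, n))) 0 j = 0.
Proof.
move=> kj; rewrite mxE big1// => l _; rewrite mxE; case: eqP => [e|]; last by rewrite mulr0.
by move: kj; rewrite -e leqNgt ltn_ord.
Qed.

Lemma mul_pid_wideK (u : 'rV[R]_k) :
  u *m (pid_mx k : 'M[R]_(k, n)) *m (pid_mx k : 'M[R]_(n, k)) = u.
Proof. by rewrite -mulmxA pid_mx_id// pid_mx_1 mulmx1. Qed.

Lemma mul_pid_narrowK (u : 'rV[R]_n) : (forall i : 'I_n, (k <= i)%N -> u 0 i = 0) ->
  u *m (pid_mx k : 'M[R]_(n, k)) *m (pid_mx k : 'M[R]_(k, n)) = u.
Proof.
move=> u0; apply/rowP => j; have [jk|kj] := ltnP j k; last first.
  by rewrite mul_pid_wide0// u0.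
rewrite (@mul_pid_wide _ (Ordinal jk))// mul_pid_narrow; congr (u 0 _).
exact: val_inj.
Qed.

End PidCoordinates.

(** The reverse inclusion of left kernels always holds, and when the rank does not drop both kernels
    have the same dimension. *)
Lemma kermx_mul_rank (F : fieldType) a b c (M : 'M[F]_(a, b)) (N : 'M[F]_(b, c)) :
  (\rank M <= \rank (M *m N))%N -> (kermx (M *m N) <= kermx M)%MS.
Proof.
move=> rMN; have sub : (kermx M <= kermx (M *m N))%MS.
  by apply/sub_kermxP; rewrite mulmxA mulmx_ker mul0mx.
rewrite -(mxrank_leqif_sup sub).2 eqn_leq (mxrank_leqif_sup sub).1/= !mxrank_ker.
exact: leq_sub2l.
Qed.

Section ConstantRank.
Context {R : realType} {m n : nat}.
Variables (f : 'rV[R]_m -> 'rV[R]_n) (W : set 'rV[R]_m) (p : 'rV[R]_m).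
Hypotheses (oW : open W) (smf : smooth_on W f) (Wp : W p).

(* If the rank [r] were less than [m], completing [r] independent components of [f]
   to local coordinates would make [f] constant along the last coordinate. *)
Theorem constant_rank_injective :
  (forall u, W u -> (\rank ('J f u) <= \rank ('J f p))%N) ->
  {in W &, injective f} -> row_free ('J f p).
Proof.
move=> rk inj; apply/negPn/negP => nfree.
have [J0 J0p] : exists J0, J0 = 'J f p by exists ('J f p).
rewrite -J0p in rk nfree.
pose r := \rank J0.
have rm : (r < m)%N by rewrite ltn_neqAle nfree rank_leq_row.
have rn : (r <= n)%N by exact: rank_leq_col.
pose L := col_ebase J0; pose U := row_ebase J0.
have Uu : U \in unitmx by exact: row_ebase_unit.
have J0E : L *m pid_mx r *m U = J0 by exact: mulmx_ebase.
(* In the bases of the rank factorization of [J0], [C] keeps the first [r] components of [f], and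
   [D] completes them with the last [m - r] source coordinates. The Jacobian of the result at [p] is
   [L *m (pid_mx r + copid_mx r)], that is [L], which is invertible. *)
pose C : 'M[R]_(n, m) := invmx U *m pid_mx r.
pose D : 'M[R]_m := L *m copid_mx r.
pose psi u := f u *m C + u *m D.
have dfW u : W u -> differentiable f u by exact: smooth_on_differentiable smf.
have Jpsi : 'J psi p = L.
  rewrite jacobian_add_linear; last exact: dfW.
  rewrite -J0p -{1}J0E /C mulmxA mulmxK// -mulmxA pid_mx_id//.
  by rewrite -mulmxDr /copid_mx addrC subrK mulmx1.
have smpsi : smooth_on W psi.
  by apply: smooth_onD => //; [exact: smooth_on_mulmx|exact: smooth_on_linear].
have Jpu : 'J psi p \in unitmx by rewrite Jpsi; exact: col_ebase_unit.
have [N [th [[oO Op OW] [thK oV smth]]]] := inverse_function oW smpsi Wp Jpu.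
set V := psi @` N in oV smth.
have thO y : V y -> N (th y) /\ psi (th y) = y.
  by move=> [u Ou <-]; rewrite thK ?inE.
pose F := f \o th.
have smF : smooth_on V F.
  apply: smooth_on_comp smth smf => // _ [y Vy <-].
  by apply: OW; have [] := thO _ Vy.
have CP : C *m (pid_mx r : 'M[R]_m) = C.
  by rewrite /C -mulmxA pid_mx_id// ltnW.
have DP : D *m (pid_mx r : 'M[R]_m) = 0.
  by rewrite /D -mulmxA mul_copid_mx_pid ?mulmx0// ltnW.
(* In the new coordinates, the components of [F] selected by [C] are the first [r] coordinates. *)
have FE y : V y -> F y *m C = y *m pid_mx r.
  move=> Vy; have [_] := thO _ Vy.
  rewrite /psi -/(F y) => /(congr1 (fun z => z *m pid_mx r)) <-.
  by rewrite mulmxDl -mulmxA CP -mulmxA DP mulmx0 addr0.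
have m0 : (0 < m)%N by exact: leq_ltn_trans rm.
have rltm : (r <= m.-1 < m)%N by apply/andP; split; rewrite -ltnS prednK.
pose lst := Ordinal (andP rltm).2.
(* The Jacobian of [F] has rank at most [r], and its product with [C] is [pid_mx r], of rank [r]; so
   both have the same left kernel, which contains the last basis vector because [r] is less than
   [m]. *)
have De0 y : V y -> 'D_(delta_mx 0 lst) F y = 0.
  move=> Vy; have dF := smooth_on_differentiable oV smF Vy.
  have JFC : 'J F y *m C = pid_mx r.
    rewrite -[RHS](jacobian_mulmxr _ y) -[C in LHS](jacobian_mulmxr C (F y)).
    rewrite -[LHS](jacobian_comp dF (differentiable_mulmxr C (F y))).
    apply: jacobian_near_eq.
    - by apply: differentiable_comp => //; exact: differentiable_mulmxr.
    - exact: differentiable_mulmxr.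
    - have : nbhs y V by exact: open_nbhs_nbhs.
      by apply: filterS => z Vz /=; rewrite FE.
  have rkF : (\rank ('J F y) <= r)%N.
    have [Oy _] := thO _ Vy.
    have dth := smooth_on_differentiable oV smth Vy.
    rewrite (jacobian_comp dth (dfW _ (OW _ Oy))).
    by rewrite (leq_trans (mxrankM_maxr _ _))// rk//; exact: OW.
  rewrite deriveEjacobian//; apply/sub_kermxP.
  apply: submx_trans (kermx_mul_rank (N := C) _); last first.
    by rewrite JFC rank_pid_mx// ltnW.
  rewrite JFC; apply/sub_kermxP; apply/rowP => j.
  rewrite -rowE !mxE /= ; case: eqP => //= _.
  by rewrite ltnNge (andP rltm).1.
pose q := psi p.
have Vq : V q by exists p.
have /nbhs_ballP[s/= s0 sV] : nbhs q V by exact: open_nbhs_nbhs.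
pose e : 'rV[R]_m := delta_mx 0 lst.
have Vqe (t : R) : 0 <= t <= s / 2 -> V (t *: e + q).
  move=> /andP[t0 ts]; apply: sV; rewrite -ball_normE/= opprD addrCA subrr addr0 normrN.
  rewrite normrZ (@le_lt_trans _ _ (s / 2))//; last first.
    by rewrite ltr_pdivrMr// ltr_pMr// ltr1n.
  rewrite (le_trans _ ts)// ger0_norm// ler_piMr//.
  by apply: mx_norm_le => // a b; rewrite mxE; case: (_ && _); rewrite ?normr1 ?normr0.
have s20 : 0 <= s / 2 by rewrite divr_ge0// ltW.
(* Two distinct points of [V] with the same value under [F], against the injectivity of [f]; the
   length [s / 2] keeps the segment inside the open ball. *)
have Feq : F (s / 2 *: e + q) = F (0 *: e + q).
  apply/rowP => j; apply/eqP; rewrite -subr_eq0 -normr_le0.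
  have /= := @line_estimate R m (fun u => F u 0 j) e q 0 (s / 2) 0 0.
  rewrite mulr0 subr0 mul0r; apply => t; rewrite min_l// max_r// => /Vqe Vt.
  have dF : derivable F (t *: e + q) e.
    by apply: diff_derivable; exact: smooth_on_differentiable smF Vt.
  split; first exact: (derivable_mxP _ _ _).1.
  have := De0 _ Vt; rewrite derive_mx// => /rowP/(_ j).
  by rewrite !mxE => ->; rewrite subrr normr0.
have V1 : V (s / 2 *: e + q) by apply: Vqe; rewrite s20 lexx.
have V0 : V (0 *: e + q) by apply: Vqe; rewrite lexx.
have [N1 p1] := thO _ V1; have [N0 p0] := thO _ V0.
have : th (s / 2 *: e + q) = th (0 *: e + q).
  by apply: inj; rewrite ?inE; [exact: OW|exact: OW|exact: Feq].
move=> /(congr1 psi); rewrite p1 p0 => /addIr /rowP/(_ lst).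
rewrite !mxE !eqxx/= !mulr1 => /eqP; rewrite mulf_eq0 gt_eqF//= invr_eq0.
by rewrite pnatr_eq0.
Qed.

End ConstantRank.

(** With [inc] and [pr] the inclusion of R^m into R^n and the projection back, and [co] the
    projector onto the complement, the two factors are the block matrices diag(L, 1) and diag(L^-1,
    1). *)
Lemma mulmx_split_inv (F : fieldType) (m n : nat) (pr : 'M[F]_(n, m))
    (inc : 'M[F]_(m, n)) (co : 'M[F]_n) (L : 'M[F]_m) :
  inc *m pr = 1%:M -> inc *m co = 0 -> co *m pr = 0 -> co *m co = co ->
  pr *m inc + co = 1%:M -> L \in unitmx ->
  (pr *m L *m inc + co) *m (pr *m invmx L *m inc + co) = 1%:M.
Proof.
move=> incpr incco copr coco princ Lu.
rewrite mulmxDl !mulmxDr !mulmxA copr !mul0mx add0r coco.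
rewrite -[pr *m L *m inc *m pr]mulmxA incpr mulmx1 mulmxK//.
by rewrite -[pr *m L *m inc *m co]mulmxA incco mulmx0 addr0.
Qed.

Section Immersion.
Context {R : realType} {m n : nat}.
Variables (f : 'rV[R]_m -> 'rV[R]_n) (W : set 'rV[R]_m) (p : 'rV[R]_m).
Hypotheses (oW : open W) (smf : smooth_on W f) (Wp : W p).
Hypothesis free : row_free ('J f p).

(* Multiplication by [pid_mx m] is u |-> (u, 0) from R^m to R^n, and the
   projection onto the first [m] coordinates from R^n to R^m. *)
Lemma immersion_straighten : exists (Phi Psi : 'rV[R]_n -> 'rV[R]_n) (N : set 'rV[R]_n),
  [/\ open N, N (p *m pid_mx m), forall z, N z -> W (z *m pid_mx m),
      smooth_on N Phi & forall u, Phi (u *m pid_mx m) = f u] /\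
  [/\ {in N, cancel Phi Psi}, open (Phi @` N) & smooth_on (Phi @` N) Psi].
Proof.
have [J0 J0p] : exists J0, J0 = 'J f p by exists ('J f p).
have fr : row_free J0 by rewrite J0p.
pose L := col_ebase J0; pose U := row_ebase J0.
have mn : (m <= n)%N by rewrite -(eqP fr) rank_leq_col.
have Uu : U \in unitmx by exact: row_ebase_unit.
have Lu : L \in unitmx by exact: col_ebase_unit.
have J0E : L *m pid_mx m *m U = J0.
  by rewrite -[RHS](mulmx_ebase J0) (eqP fr : \rank J0 = m).
pose pr : 'M[R]_(n, m) := pid_mx m; pose inc : 'M[R]_(m, n) := pid_mx m.
(* The row space of [J0] is spanned by the first [m] rows of [U]; [D] adds the remaining rows as
   transverse directions. The Jacobian of [Phi] becomes [(pr *m L *m inc + copid_mx m) *m U]. *)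
pose D := copid_mx m *m U.
pose W2 : set 'rV[R]_n := [set z | W (z *m pr)].
have oW2 : open W2.
  apply: open_comp oW => z _; exact: (mulmxr_continuous (M := pr)).
pose Phi z := f (z *m pr) *m 1%:M + z *m D.
have incpr : inc *m pr = 1%:M by rewrite pid_mx_id// pid_mx_1.
have incco : inc *m copid_mx m = 0 by rewrite mul_pid_mx_copid.
have Phif u : Phi (u *m inc) = f u.
  by rewrite /Phi -!mulmxA incpr (mulmxA inc) incco mul0mx mulmx0 addr0 !mulmx1.
have sfpr : smooth_on W2 (fun z => f (z *m pr)).
  apply: (smooth_on_comp oW2 oW _ (smooth_on_linear oW2 pr) smf).
  by move=> _ [z Wz <-].
have sPhi : smooth_on W2 Phi.
  apply: smooth_onD => //; last exact: smooth_on_linear.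
  exact: smooth_on_mulmx.
pose z0 := p *m inc.
have z0p : z0 *m pr = p by rewrite -mulmxA incpr mulmx1.
have W2z0 : W2 z0 by rewrite /W2/= z0p.
have dfp : differentiable f (mulmxr pr z0).
  by rewrite /= z0p; exact: smooth_on_differentiable smf Wp.
have Junit : 'J Phi z0 \in unitmx.
  rewrite jacobian_add_linear; last exact: smooth_on_differentiable sfpr W2z0.
  rewrite mulmx1 (_ : (fun z => _) = f \o mulmxr pr)//.
  rewrite jacobian_comp//; last exact: differentiable_mulmxr.
  rewrite jacobian_mulmxr/= z0p -J0p -J0E !mulmxA /D -mulmxDl unitmx_mul Uu andbT.
  apply: (@mulmx1_unit _ _ _ (pr *m invmx L *m inc + copid_mx m) _).1.
  apply: mulmx_split_inv => //.
  - by rewrite mul_copid_mx_pid.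
  - by rewrite copid_mx_id.
  - by rewrite pid_mx_id// /copid_mx addrC subrK.
have [N [Psi [[oO Oz OW2] [PsiK oV sPsi]]]] := inverse_function oW2 sPhi W2z0 Junit.
exists Phi, Psi, N; split; split=> //; exact: smooth_on_sub sPhi.
Qed.

End Immersion.

(** * Smooth maps in charts *)

Lemma open_preimage_for (X Y : topologicalType) (P : set X) (V : set Y) (f : X -> Y) :
  open P -> open V -> (forall x, P x -> {for x, continuous f}) ->
  open (P `&` f @^-1` V).
Proof.
move=> oP oV cf; rewrite openE => x [Px Vfx].
apply: filterI; first exact: open_nbhs_nbhs.
by apply: (cf x Px); exact: open_nbhs_nbhs.
Qed.

Lemma continuous_for_near_eq (X Y : topologicalType) (P : set X) (f g : X -> Y) x :
  open P -> P x -> (forall y, P y -> f y = g y) ->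
  {for x, continuous f} -> {for x, continuous g}.
Proof.
move=> oP Px fg cf; rewrite /prop_for /continuous_at -fg//.
apply: cvg_trans cf; apply: near_eq_cvg.
have : nbhs x P by exact: open_nbhs_nbhs.
by apply: filterS => y Py; rewrite fg.
Qed.

Section Chart.
Context {R : realType} {n : nat} {X : topologicalType} (c : chart R n X).

Lemma chartK x : chart_dom c x -> chart_inv c (c x) = x.
Proof. by move=> cx; rewrite chart_funK ?inE. Qed.

Lemma chart_inj x y : chart_dom c x -> chart_dom c y -> c x = c y -> x = y.
Proof. by move=> cx cy cxy; rewrite -(chartK cx) cxy chartK. Qed.

Lemma chart_image_open (P : set X) : open P -> P `<=` chart_dom c -> open (c @` P).
Proof.
move=> oP Pc.
have -> : c @` P = (c @` chart_dom c) `&` chart_inv c @^-1` P.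
  apply/seteqP; split=> [_ [x Px <-]|_ [[x cx <-]]]; rewrite /= chartK//.
  - by split=> //; exists x => //; exact: Pc.
  - exact: Pc.
  - by exists x.
by apply: open_preimage_for oP _; [exact: chart_img_open|exact: chart_inv_cts].
Qed.

Lemma chart_image_openI (P : set X) : open P -> open (c @` (chart_dom c `&` P)).
Proof.
move=> oP; apply: chart_image_open; last by move=> x [].
by apply: openI => //; exact: chart_dom_open.
Qed.

End Chart.

Section SmoothAt.
Context {R : realType}.

(** The neighbourhood [P] is mapped into the domain of [d], so continuity at [x] is built in and
    composition only requires shrinking [P]. *)
Definition smooth_at n m (X Y : topologicalType) (c : chart R n X) (d : chart R m Y)
    (F : X -> Y) (x : X) : Prop :=
  exists P : set X, [/\ open P, P x, P `<=` chart_dom c,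
    forall y, P y -> chart_dom d (F y) & smooth_on (c @` P) (d \o F \o chart_inv c)].

Lemma smooth_at_continuous n m (X Y : topologicalType) (c : chart R n X) (d : chart R m Y)
  (F : X -> Y) x : smooth_at c d F x -> {for x, continuous F}.
Proof.
move=> [P [oP Px Pc Pd sF]].
apply: (@continuous_for_near_eq _ _ P (chart_inv d \o (d \o F \o chart_inv c) \o c)) => //.
  by move=> y Py /=; rewrite (chartK (Pc y Py)) chartK//; exact: Pd.
apply: continuous_comp; first by apply: chart_fun_cts; exact: Pc.
apply: continuous_comp.
  by apply: (Ck_on_continuous (sF 0%N)); exists x.
apply: chart_inv_cts; exists (F x); first exact: Pd.
by rewrite /= chartK//; exact: Pc.
Qed.

Lemma smooth_at_near n m (X Y : topologicalType) (c : chart R n X) (d : chart R m Y)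
  (F : X -> Y) x : smooth_at c d F x ->
  exists P : set X, [/\ open P, P x & forall y, P y -> smooth_at c d F y].
Proof. by move=> [P [oP Px Pc Pd sF]]; exists P; split=> // y Py; exists P. Qed.

Lemma smooth_at_restrict n m (X Y : topologicalType) (c : chart R n X) (d : chart R m Y)
  (F : X -> Y) x (Q : set X) : smooth_at c d F x -> open Q -> Q x ->
  exists P : set X, [/\ open P, P x, P `<=` chart_dom c `&` Q,
    forall y, P y -> chart_dom d (F y) & smooth_on (c @` P) (d \o F \o chart_inv c)].
Proof.
move=> [P [oP Px Pc Pd sF]] oQ Qx; exists (P `&` Q); split.
- exact: openI.
- by [].
- by move=> y [/Pc].
- by move=> y [/Pd].
- apply: smooth_on_sub sF.
  + exact: chart_image_open.
  + by apply: chart_image_open; [exact: openI|move=> y [/Pc]].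
  + by move=> _ [y [Py _] <-]; exists y.
Qed.

Lemma smooth_at_comp n m p (X Y Z : topologicalType) (c : chart R n X) (d : chart R m Y)
  (e : chart R p Z) (F : X -> Y) (H : Y -> Z) x :
  smooth_at c d F x -> smooth_at d e H (F x) -> smooth_at c e (H \o F) x.
Proof.
move=> sF [Q [oQ QFx Qd Qe sH]].
have [P [oP Px Psm]] := smooth_at_near sF.
have oPQ : open (P `&` F @^-1` Q).
  by apply: open_preimage_for => // y /Psm; exact: smooth_at_continuous.
have [P' [oP' Px' Pc Pd sF']] := smooth_at_restrict sF oPQ (conj Px QFx).
exists P'; split=> //; first by move=> y /Pc[].
  by move=> y /Pc[_ [_ /Qe]].
have oc : open (c @` P') by apply: chart_image_open => // y /Pc[].
apply: (@smooth_on_ext _ _ _ _ ((e \o H \o chart_inv d) \o (d \o F \o chart_inv c))) => //.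
  move=> _ /[!inE] -[y Py <-] /=; rewrite (chartK (Pc _ Py).1) chartK//.
  exact: Pd.
apply: smooth_on_comp sF' sH => //; first exact: chart_image_open.
move=> _ [_ [y Py <-] <-] /=; have [cy [_ Qy]] := Pc _ Py.
by rewrite chartK//; exists (F y).
Qed.

Lemma smooth_at_differentiable n m (X Y : topologicalType) (c : chart R n X)
    (d : chart R m Y) (F : X -> Y) x : smooth_at c d F x ->
  differentiable (d \o F \o chart_inv c) (c x).
Proof.
move=> [P [oP Px Pc Pd sF]].
by apply: (smooth_on_differentiable _ sF); [exact: chart_image_open|exists x].
Qed.

(** The coordinate expression of [H \o F] and the composite of the two coordinate expressions agree
    only near [c x], where [chart_inv d] undoes [d]; this suffices for derivatives. *)
Lemma smooth_at_jacobian_comp n m p (X Y Z : topologicalType) (c : chart R n X)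
  (d : chart R m Y) (e : chart R p Z) (F : X -> Y) (H : Y -> Z) x :
  smooth_at c d F x -> smooth_at d e H (F x) ->
  'J (e \o (H \o F) \o chart_inv c) (c x) =
  'J (d \o F \o chart_inv c) (c x) *m 'J (e \o H \o chart_inv d) (d (F x)).
Proof.
move=> sF sH.
have dF := smooth_at_differentiable sF; have dH := smooth_at_differentiable sH.
have dHF := smooth_at_differentiable (smooth_at_comp sF sH).
have [P [oP Px Pc Pd _]] := sF.
have E : d (F x) = (d \o F \o chart_inv c) (c x) by rewrite /= chartK//; exact: Pc.
rewrite E in dH *; rewrite -(jacobian_comp dF dH).
apply: (jacobian_near_eq dHF (differentiable_comp dF dH)).
have : nbhs (c x) (c @` P).
  by apply: open_nbhs_nbhs; split; [exact: chart_image_open|exists x].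
apply: filterS => _ [y Py <-] /=; rewrite (chartK (Pc _ Py)) chartK//.
exact: Pd.
Qed.

Lemma smooth_on_smooth_at n m (X Y : topologicalType) (c : chart R n X) (d : chart R m Y)
    (F : X -> Y) : open (chart_dom c `&` F @^-1` chart_dom d) ->
  (forall x, chart_dom c x -> chart_dom d (F x) -> smooth_at c d F x) ->
  smooth_on (c @` (chart_dom c `&` F @^-1` chart_dom d)) (d \o F \o chart_inv c).
Proof.
move=> oI sF; apply: smooth_on_local.
  by apply: chart_image_open => // x [].
move=> _ [x [cx dFx] <-]; have [P [oP Px Pc Pd sP]] := sF x cx dFx.
by exists (c @` P); split=> //; exact: chart_image_open.
Qed.

Lemma smooth_map_of_smooth_at n m (X Y : topologicalType) (A : set (chart R n X))
    (B : set (chart R m Y)) (F : X -> Y) :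
  (forall x, exists2 c, A c & chart_dom c x) ->
  (forall y, exists2 d, B d & chart_dom d y) ->
  (forall c d x, A c -> B d -> chart_dom c x -> chart_dom d (F x) -> smooth_at c d F x) ->
  smooth_map A B F.
Proof.
move=> cA cB sF; have cF : continuous F.
  move=> x; have [c Ac cx] := cA x; have [d Bd dy] := cB (F x).
  by apply: smooth_at_continuous (sF c d x _ _ _ _).
split=> // c d Ac Bd; apply: smooth_on_smooth_at.
  apply: open_preimage_for => *; [exact: chart_dom_open|exact: chart_dom_open|exact: cF].
by move=> x cx dx; exact: sF.
Qed.

Lemma smooth_map_smooth_at n m (X Y : topologicalType) (A : set (chart R n X))
    (B : set (chart R m Y)) (F : X -> Y) c d x :
  smooth_map A B F -> A c -> B d -> chart_dom c x -> chart_dom d (F x) ->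
  smooth_at c d F x.
Proof.
move=> [cF sF] Ac Bd cx dx; exists (chart_dom c `&` F @^-1` chart_dom d); split.
- by apply: open_preimage_for => *; [exact: chart_dom_open|exact: chart_dom_open|exact: cF].
- by [].
- by move=> y [].
- by move=> y [].
- exact: sF.
Qed.

Lemma compatible_smooth_at n (X : topologicalType) (c d : chart R n X) x :
  chart_compatible c d -> chart_dom c x -> chart_dom d x -> smooth_at c d id x.
Proof.
move=> [scd _] cx dx; exists (chart_dom c `&` chart_dom d); split=> //.
- by apply: openI; exact: chart_dom_open.
- by move=> y [].
Qed.

Lemma chart_compatibleC n (X : topologicalType) (c d : chart R n X) :
  chart_compatible c d -> chart_compatible d c.
Proof. by move=> [scd sdc]; split; rewrite setIC. Qed.

Lemma smooth_at_compatible n (X : topologicalType) (c d : chart R n X) :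
  (forall x, chart_dom c x -> chart_dom d x -> smooth_at c d id x) ->
  (forall x, chart_dom c x -> chart_dom d x -> smooth_at d c id x) ->
  chart_compatible c d.
Proof.
move=> scd sdc; have oI : open (chart_dom c `&` chart_dom d).
  by apply: openI; exact: chart_dom_open.
split; first exact: (@smooth_on_smooth_at _ _ _ _ c d id).
rewrite setIC in oI *; apply: (@smooth_on_smooth_at _ _ _ _ d c id) => // x dx cx.
exact: sdc.
Qed.

(** The transition passes through a chart of [A] around [x]: charts compatible with an atlas are
    compatible with each other. *)
Lemma maximal_atlas_smooth_at n (X : topologicalType) (A : set (chart R n X))
    (c d : chart R n X) x : (forall x : X, exists2 c, A c & chart_dom c x) ->
  maximal_atlas A c -> maximal_atlas A d -> chart_dom c x -> chart_dom d x ->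
  smooth_at c d id x.
Proof.
move=> cA Mc Md cx dx; have [a Aa ax] := cA x.
apply: (@smooth_at_comp _ _ _ _ _ _ c a d id id).
  exact: compatible_smooth_at (Mc _ Aa) cx ax.
exact: compatible_smooth_at (chart_compatibleC (Md _ Aa)) ax dx.
Qed.

End SmoothAt.

(** * Product charts and the partial maps of a smooth map *)

Section ProductChart.
Context {R : realType} {n m : nat} {X Y : topologicalType}.
Variables (a : chart R n X) (b : chart R m Y).

Let dom := chart_dom a `*` chart_dom b.
Let fn (p : X * Y) : 'rV[R]_(n + m) := row_mx (a p.1) (b p.2).
Let inv (u : 'rV[R]_(n + m)) : X * Y := (chart_inv a (lsubmx u), chart_inv b (rsubmx u)).

Let dom_open : open dom.
Proof.
have -> : dom = fst @^-1` chart_dom a `&` snd @^-1` chart_dom b by [].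
apply: openI; apply: open_comp; try exact: chart_dom_open.
- by move=> p _; exact: cvg_fst.
- by move=> p _; exact: cvg_snd.
Qed.

Let img : fn @` dom = [set u | (a @` chart_dom a) (lsubmx u)] `&`
                      [set u | (b @` chart_dom b) (rsubmx u)].
Proof.
apply/seteqP; split=> [_ [[x y] [/= ax bt] <-]|u [[x ax xu] [y bt yu]]].
  by split; rewrite /= /fn ?row_mxKl ?row_mxKr; [exists x|exists y].
by exists (x, y) => //; rewrite /fn /= xu yu hsubmxK.
Qed.

Let img_open : open (fn @` dom).
Proof.
rewrite img; apply: openI; apply: open_comp; try exact: chart_img_open.
- by move=> u _; exact: continuous_lsubmx.
- by move=> u _; exact: continuous_rsubmx.
Qed.

Let funK : {in dom, cancel fn inv}.
Proof.
by move=> [x y] /[!inE] -[/= ax bt]; rewrite /inv /fn row_mxKl row_mxKr !chartK.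
Qed.

Let fun_cts p : dom p -> {for p, continuous fn}.
Proof.
case: p => x y [/= ax bt]; apply/continuous_mxP => i j.
rewrite /fn; case: (splitP j) => k jk.
  have -> : (fun p : X * Y => (row_mx (a p.1) (b p.2)) i j) = (fun p => a p.1 i k).
    apply/funext => p; have -> : j = lshift m k by exact: val_inj.
    by rewrite row_mxEl.
  apply: (@continuous_comp _ _ _ fst (fun z => a z i k)); first exact: cvg_fst.
  exact: (continuous_mxP _ _).1 (chart_fun_cts ax) i k.
have -> : (fun p : X * Y => (row_mx (a p.1) (b p.2)) i j) = (fun p => b p.2 i k).
  apply/funext => p; have -> : j = rshift n k by exact: val_inj.
  by rewrite row_mxEr.
apply: (@continuous_comp _ _ _ snd (fun z => b z i k)); first exact: cvg_snd.
exact: (continuous_mxP _ _).1 (chart_fun_cts bt) i k.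
Qed.

Let inv_cts u : (fn @` dom) u -> {for u, continuous inv}.
Proof.
rewrite img => -[/= au bu].
have ca : {for u, continuous (chart_inv a \o (lsubmx : 'rV[R]_(n + m) -> 'rV[R]_n))}.
  by apply: continuous_comp; [exact: continuous_lsubmx|exact: chart_inv_cts].
have cb : {for u, continuous (chart_inv b \o (rsubmx : 'rV[R]_(n + m) -> 'rV[R]_m))}.
  by apply: continuous_comp; [exact: continuous_rsubmx|exact: chart_inv_cts].
exact: cvg_pair ca cb.
Qed.

(** [prod_atlas] only describes its members; this exhibits one for each pair of charts. *)
Definition product_chart : chart R (n + m) (X * Y)%type :=
  Chart dom_open img_open funK fun_cts inv_cts.

Lemma product_chart_atlas (A : set (chart R n X)) (B : set (chart R m Y)) :
  A a -> B b -> prod_atlas A B product_chart.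
Proof. by move=> Aa Bb; exists a, b. Qed.

End ProductChart.

Section PartialMaps.
Context {R : realType} {n m p : nat} {X Y Z : topologicalType}.
Variables (A : set (chart R n X)) (B : set (chart R m Y)) (C : set (chart R p Z)).
Variable (F : X * Y -> Z).
Hypotheses (cA : forall x : X, exists2 c, A c & chart_dom c x)
           (cB : forall x : Y, exists2 c, B c & chart_dom c x)
           (sF : smooth_map (prod_atlas A B) C F).

(** In product coordinates the embedding [z |-> (x, z)] is the affine map that prepends the constant
    row [a x]. *)
Lemma smooth_at_pairr b c x y : B b -> C c -> chart_dom b y -> chart_dom c (F (x, y)) ->
  smooth_at b c (fun z => F (x, z)) y.
Proof.
move=> Bb Cc bt cF; have [a Aa ax] := cA x.
have ed : chart_dom (product_chart a b) (x, y) by split.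
have := smooth_map_smooth_at sF (product_chart_atlas Aa Bb) Cc ed cF.
set e := product_chart a b => -[P [oP Pxy Pe Pc sP]].
have oQ : open [set z | P (x, z)].
  apply: (open_comp _ oP) => z _.
  by apply: cvg_pair; [exact: cvg_cst|exact: cvg_id].
exists [set z | P (x, z)]; split=> //.
- by move=> z /Pe[].
- by move=> z /Pc.
have oW : open (b @` [set z | P (x, z)]) by apply: chart_image_open => // z /Pe[].
pose i (v : 'rV[R]_m) := v *m row_mx 0 1%:M + row_mx (a x) 0.
have iE v : i v = row_mx (a x) v.
  by rewrite /i mul_mx_row mulmx0 mulmx1 add_row_mx add0r addr0.
apply: (@smooth_on_ext _ _ _ _ ((c \o F \o chart_inv e) \o i)) => //.
  move=> _ /[!inE] -[z Pz <-]; have [_ bz] := Pe _ Pz.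
  by rewrite /= iE row_mxKl row_mxKr !chartK.
apply: smooth_on_comp sP => //; first exact: chart_image_open.
  by move=> _ [_ [z Pz <-] <-]; exists (x, z) => //; rewrite iE.
exact: smooth_on_affine.
Qed.

Lemma smooth_at_pairl a c x y : A a -> C c -> chart_dom a x -> chart_dom c (F (x, y)) ->
  smooth_at a c (fun z => F (z, y)) x.
Proof.
move=> Aa Cc ax cF; have [b Bb bt] := cB y.
have ed : chart_dom (product_chart a b) (x, y) by split.
have := smooth_map_smooth_at sF (product_chart_atlas Aa Bb) Cc ed cF.
set e := product_chart a b => -[P [oP Pxy Pe Pc sP]].
have oQ : open [set z | P (z, y)].
  apply: (open_comp _ oP) => z _.
  by apply: cvg_pair; [exact: cvg_id|exact: cvg_cst].
exists [set z | P (z, y)]; split=> //.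
- by move=> z /Pe[].
- by move=> z /Pc.
have oW : open (a @` [set z | P (z, y)]) by apply: chart_image_open => // z /Pe[].
pose i (v : 'rV[R]_n) := v *m row_mx 1%:M 0 + row_mx 0 (b y).
have iE v : i v = row_mx v (b y).
  by rewrite /i mul_mx_row mulmx0 mulmx1 add_row_mx add0r addr0.
apply: (@smooth_on_ext _ _ _ _ ((c \o F \o chart_inv e) \o i)) => //.
  move=> _ /[!inE] -[z Pz <-]; have [az _] := Pe _ Pz.
  by rewrite /= iE row_mxKl row_mxKr !chartK.
apply: smooth_on_comp sP => //; first exact: chart_image_open.
  by move=> _ [_ [z Pz <-] <-]; exists (z, y) => //; rewrite iE.
exact: smooth_on_affine.
Qed.

End PartialMaps.

(** * Slice charts and the induced atlas *)

Section Subset.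
Context {X : topologicalType} {S : set X}.

Lemma set_val_continuous : continuous (set_val : S -> X).
Proof. exact: initial_continuous. Qed.

Lemma continuous_for_set_val (T : topologicalType) (f : T -> S) x :
  {for x, continuous (set_val \o f)} -> {for x, continuous f}.
Proof.
move=> cf U [_ [[W oW <-] /= Wfx WU]].
have : nbhs x ((set_val \o f) @^-1` W) by apply: cf; exact: open_nbhs_nbhs.
by apply: filterS => y Wy; exact: WU.
Qed.

Lemma hausdorff_set_type : hausdorff_space X -> hausdorff_space S.
Proof.
move=> hX p q pq; apply: val_inj; rewrite -!set_valE; apply: hX => U V pU qV.
have [z [Uz Vz]] := pq _ _ (set_val_continuous pU) (set_val_continuous qV).
by exists (set_val z).
Qed.

Lemma second_countable_set_type : @second_countable X -> @second_countable S.
Proof.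
move=> [B cB [oB bB]]; exists [set set_val @^-1` U | U in B].
  exact: sub_countable (card_image_le _ _) cB.
split.
  move=> _ [U BU <-]; apply: open_comp (oB _ BU) => x _; exact: set_val_continuous.
move=> x U [_ [[W oW <-] /= Wx WU]].
have [V [BV Vx] VW] := bB (set_val x) W (open_nbhs_nbhs (conj oW Wx)).
exists (set_val @^-1` V); last by move=> y Vy; apply: WU; exact: VW.
by split=> //; exists V.
Qed.

Lemma set_type_exists x : S x -> exists y : S, set_val y = x.
Proof. by move=> Sx; exists (exist _ x (mem_set Sx)). Qed.

Lemma set_val_inj : injective (set_val : S -> X).
Proof. exact: val_inj. Qed.

End Subset.

Section Slice.
Context {R : realType} {n k : nat} {X : topologicalType} (A : set (chart R n X)).
Variables (S : set X) (kn : (k <= n)%N).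

Let pr : 'M[R]_(n, k) := pid_mx k.
Let inc : 'M[R]_(k, n) := pid_mx k.

Lemma slice_chartK c x : slice_chart A k S c -> chart_dom c x -> S x ->
  c x *m pr *m inc = c x.
Proof.
move=> [_ sE] cx Sx; apply: mul_pid_narrowK => //.
have : (c @` (chart_dom c `&` S)) (c x) by exists x.
by rewrite sE => -[].
Qed.

Lemma slice_chart_sub c x (u : 'rV[R]_k) : slice_chart A k S c -> chart_dom c x ->
  c x = u *m inc -> S x.
Proof.
move=> [_ sE] cx cxu.
have : (c @` (chart_dom c `&` S)) (c x).
  rewrite sE; split; first by exists x.
  by move=> i ki; rewrite cxu mul_pid_wide0.
by move=> [y [cy Sy] /(chart_inj cy cx) <-].
Qed.

Section Restrict.
Variables (x0 : S) (c : chart R n X).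
Hypothesis sc : slice_chart A k S c.

Let dom : set S := set_val @^-1` chart_dom c.
Let fn (y : S) : 'rV[R]_k := c (set_val y) *m pr.
(** The inverse has to take values in [S], so it is chosen there, with [x0] as the default outside
    the image. On the image it agrees with [chart_inv c] after zero-padding, which gives its
    continuity. *)
Let inv (u : 'rV[R]_k) : S := xget x0 [set y | dom y /\ fn y = u].

Let fnK (y : S) : dom y -> fn y *m inc = c (set_val y).
Proof. by move=> dy; apply: slice_chartK => //; exact: set_valP. Qed.

Let fn_inj y z : dom y -> dom z -> fn y = fn z -> y = z.
Proof.
move=> dy dz yz; apply: set_val_inj; apply: (chart_inj dy dz).
by rewrite -fnK// yz fnK.
Qed.

Let invK y : dom y -> inv (fn y) = y.
Proof.
move=> dy; rewrite /inv; case: xgetP => [z _ [dz /fn_inj]|/(_ y)[]]; last by [].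
exact.
Qed.

Let dom_open : open dom.
Proof.
by apply: open_comp (chart_dom_open c) => y _; exact: set_val_continuous.
Qed.

(** By the slice condition a point of the chart with zero-padded coordinates lies in [S]; the image
    is thus the preimage of an open set. *)
Let img : fn @` dom = (mulmxr inc : 'rV[R]_k -> 'rV[R]_n) @^-1` (c @` chart_dom c).
Proof.
apply/seteqP; split=> [_ [y dy <-]|u [x cx cxu]] /=.
  by rewrite fnK//; exists (set_val y).
have [y yx] := set_type_exists (slice_chart_sub sc cx cxu).
exists y; rewrite /dom /fn /= yx//.
by rewrite cxu /= mul_pid_wideK.
Qed.

Let img_open : open (fn @` dom).
Proof.
rewrite img; apply: (@open_comp _ _ (mulmxr inc : 'rV[R]_k -> 'rV[R]_n)).
  by move=> u _; exact: mulmxr_continuous.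
exact: chart_img_open.
Qed.

Let funK : {in dom, cancel fn inv}.
Proof. by move=> y /[!inE] /invK. Qed.

Let fun_cts y : dom y -> {for y, continuous fn}.
Proof.
move=> dy; apply: (@continuous_comp _ _ _ (c \o set_val) (mulmxr pr)).
  apply: continuous_comp; first exact: set_val_continuous.
  exact: chart_fun_cts.
exact: mulmxr_continuous.
Qed.

Let inv_cts u : (fn @` dom) u -> {for u, continuous inv}.
Proof.
move=> fu; apply: continuous_for_set_val.
apply: (@continuous_for_near_eq _ _ (fn @` dom) (chart_inv c \o mulmxr inc)) => //.
  by move=> _ [y dy <-] /=; rewrite invK// fnK// chartK.
apply: continuous_comp; first exact: mulmxr_continuous.
by apply: chart_inv_cts; move: fu; rewrite img.
Qed.

Definition slice_restrict : chart R k S :=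
  Chart dom_open img_open funK fun_cts inv_cts.

Lemma slice_restrict_atlas : submanifold_atlas A slice_restrict.
Proof.
exists c; split=> // y dy i j ij.
by rewrite /= /fn mul_pid_narrow//; congr (c _ 0 _); exact: val_inj.
Qed.

End Restrict.

Lemma submanifold_atlasE (b : chart R k S) : submanifold_atlas A b ->
  exists c, [/\ slice_chart A k S c, chart_dom b = set_val @^-1` chart_dom c &
    forall y, chart_dom b y -> b y = c (set_val y) *m pr /\ b y *m inc = c (set_val y)].
Proof.
move=> [c [sc db bE]]; exists c; split=> // y dy.
have E : b y = c (set_val y) *m pr.
  apply/rowP => i; rewrite (bE y dy i (widen_ord kn i))// mul_pid_narrow//.
split=> //; rewrite E; apply: slice_chartK => //; last exact: set_valP.
by move: dy; rewrite db.
Qed.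

Hypothesis cA : forall x : X, exists2 c, A c & chart_dom c x.

(** In coordinates the transition is zero-padding, then the transition between the slice charts of
    [X], then truncation. *)
Lemma submanifold_smooth_at (b1 b2 : chart R k S) y :
  submanifold_atlas A b1 -> submanifold_atlas A b2 ->
  chart_dom b1 y -> chart_dom b2 y -> smooth_at b1 b2 id y.
Proof.
move=> /submanifold_atlasE[c1 [[Mc1 sc1] d1 E1]].
move=> /submanifold_atlasE[c2 [[Mc2 sc2] d2 E2]] y1 y2.
have cy1 : chart_dom c1 (set_val y) by move: y1; rewrite d1.
have cy2 : chart_dom c2 (set_val y) by move: y2; rewrite d2.
have [P [oP Py Pc1 Pc2 sP]] := maximal_atlas_smooth_at cA Mc1 Mc2 cy1 cy2.
pose Q : set S := set_val @^-1` P.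
have oQ : open Q by apply: open_comp oP => z _; exact: set_val_continuous.
have Q1 : Q `<=` chart_dom b1 by rewrite d1 => z /Pc1.
have Q2 : Q `<=` chart_dom b2 by rewrite d2 => z /Pc2.
exists Q; split=> //.
have oc : open (c1 @` P) by exact: chart_image_open.
have ob : open (b1 @` Q) by exact: chart_image_open.
pose f u := (c2 \o id \o chart_inv c1) (u *m inc) *m pr.
have sf : smooth_on (b1 @` Q) f.
  apply: smooth_on_mulmx => //.
  apply: (@smooth_on_comp _ _ _ _ _ (c1 @` P) (fun u => u *m inc)) sP => //.
    move=> _ [_ [z Qz <-] <-]; exists (set_val z) => //.
    by have [_ ->] := E1 z (Q1 _ Qz).
  exact: smooth_on_linear.
apply: smooth_on_ext sf => // _ /[!inE] -[z Qz <-]; rewrite /f /=.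
have [_ ->] := E1 z (Q1 _ Qz); rewrite chartK; last exact: Pc1.
by rewrite chartK; [have [-> _] := E2 z (Q2 _ Qz)|exact: Q1].
Qed.

Lemma submanifold_smooth_manifold : S !=set0 -> hausdorff_space X -> @second_countable X ->
  (forall x, S x -> exists2 c, slice_chart A k S c & chart_dom c x) ->
  smooth_manifold (@submanifold_atlas R n X A k S).
Proof.
move=> [x Sx] hX sX cS; have [x0 _] := set_type_exists Sx; split.
- exact: hausdorff_set_type.
- exact: second_countable_set_type.
- move=> y; have [c sc cy] := cS _ (set_valP y).
  by exists (slice_restrict x0 sc) => //; exact: slice_restrict_atlas.
- move=> b1 b2 Ab1 Ab2; apply: smooth_at_compatible => y b1y b2y;
    exact: submanifold_smooth_at.
Qed.

End Slice.

(** * Orbits *)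

Section ChangeOfCoordinates.
Context {R : realType} {n : nat} {X : topologicalType} (a : chart R n X).
Variables (Phi Psi : 'rV[R]_n -> 'rV[R]_n) (N : set 'rV[R]_n) (M : set X).
Hypotheses (oN : open N) (oPhiN : open (Phi @` N)) (PhiK : {in N, cancel Phi Psi}).
Hypotheses (sPhi : smooth_on N Phi) (sPsi : smooth_on (Phi @` N) Psi) (oM : open M).

Let dom : set X := (chart_dom a `&` M) `&` a @^-1` (Phi @` N).
Let fn : X -> 'rV[R]_n := Psi \o a.
Let inv : 'rV[R]_n -> X := chart_inv a \o Phi.

Let oaM : open (chart_dom a `&` M).
Proof. by apply: openI => //; exact: chart_dom_open. Qed.

Let dom_open : open dom.
Proof. by apply: open_preimage_for => // x [ax _]; exact: chart_fun_cts. Qed.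

Let img : fn @` dom = N `&` Phi @^-1` (a @` (chart_dom a `&` M)).
Proof.
apply/seteqP; split=> [_ [y [aMy [z Nz zy]] <-]|z [Nz [y aMy yz]]].
  by rewrite /fn /= -zy PhiK ?inE//; split=> //; exists y.
exists y; last by rewrite /fn /= yz PhiK ?inE.
by split=> //; exists z.
Qed.

Let Phi_cts z : N z -> {for z, continuous Phi}.
Proof. exact: Ck_on_continuous (sPhi 0%N). Qed.

Let img_open : open (fn @` dom).
Proof.
by rewrite img; apply: open_preimage_for => //; exact: chart_image_openI.
Qed.

Let domK y : dom y -> Phi (fn y) = a y.
Proof. by move=> [_ [z Nz zy]]; rewrite /fn /= -zy PhiK ?inE. Qed.

Let funK : {in dom, cancel fn inv}.
Proof. by move=> y /[!inE] dy; rewrite /inv /= domK// chartK//; case: dy => -[]. Qed.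

Let fun_cts y : dom y -> {for y, continuous fn}.
Proof.
move=> [[ay _] Ny]; apply: continuous_comp; first exact: chart_fun_cts.
exact: Ck_on_continuous (sPsi 0%N) Ny.
Qed.

Let inv_cts u : (fn @` dom) u -> {for u, continuous inv}.
Proof.
rewrite img => -[Nu [y [ay _] yu]]; apply: continuous_comp; first exact: Phi_cts.
by apply: chart_inv_cts; exists y.
Qed.

(** The chart [a] followed by [Psi], on a domain cut down by [M]; this cut is what will remove the
    returns of the orbit. *)
Definition change_chart : chart R n X := Chart dom_open img_open funK fun_cts inv_cts.

(** Compatibility with [a] is the smoothness of [Phi] and [Psi]; any other chart of the atlas is
    reached through [a]. *)
Lemma change_chart_maximal (A : set (chart R n X)) :
  (forall c d, A c -> A d -> chart_compatible c d) -> A a -> maximal_atlas A change_chart.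
Proof.
move=> AA Aa d Ad.
have sub : dom `<=` chart_dom a by move=> y [[]].
have sa y : dom y -> smooth_at change_chart a id y.
  move=> dy; exists dom; split=> //.
  apply: (@smooth_on_ext _ _ _ _ Phi); first exact: img_open.
    move=> _ /[!inE] -[z dz <-]; have Ez : Phi (fn z) = a z by exact: domK.
    by rewrite /= /inv /= Ez chartK//; exact: sub.
  have sN : fn @` dom `<=` N by rewrite img => z [].
  exact: smooth_on_sub oN img_open sN sPhi.
have as_ y : dom y -> smooth_at a change_chart id y.
  move=> dy; exists dom; split=> //.
  have oc : open (a @` dom) by exact: chart_image_open.
  apply: (@smooth_on_ext _ _ _ _ Psi) => //.
    by move=> _ /[!inE] -[z dz <-]; rewrite /= chartK//; exact: sub.
  have sN : a @` dom `<=` Phi @` N by move=> _ [z [_ Nz] <-].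
  exact: smooth_on_sub oPhiN oc sN sPsi.
apply: smooth_at_compatible => y dy ddy; have ay := sub _ dy.
  exact: (@smooth_at_comp R n n n X X X change_chart a d id id y (sa y dy)
    (compatible_smooth_at (AA _ _ Aa Ad) ay ddy)).
exact: (@smooth_at_comp R n n n X X X d a change_chart id id y
  (compatible_smooth_at (AA _ _ Ad Aa) ddy ay) (as_ y dy)).
Qed.

End ChangeOfCoordinates.

(** Local compactness, carried over from a closed ball in coordinates by the inverse chart. *)
Lemma chart_compact_nbhs (R : realType) n (X : topologicalType) (c : chart R n X) x :
  chart_dom c x -> exists2 K, compact K & nbhs x K.
Proof.
move=> cx.
have : nbhs (c x) (c @` chart_dom c).
  by apply: open_nbhs_nbhs; split; [exact: chart_img_open|exists x].
move=> /nbhs_ballP[r/= r0 rc].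
have r20 : 0 < r / 2 by rewrite divr_gt0.
pose C : set 'rV[R]_n := closed_ball_ Num.norm (c x) (r / 2).
have Cc : C `<=` c @` chart_dom c.
  move=> u Cu; apply: rc; rewrite -ball_normE/=.
  by rewrite (le_lt_trans Cu)// ltr_pdivrMr// ltr_pMr// ltr1n.
exists (chart_inv c @` C).
  apply: continuous_compact.
    apply: continuous_in_subspaceT => u /[!inE] Cu; apply: chart_inv_cts; exact: Cc.
  apply: bounded_closed_compact; last exact: closed_closed_ball_.
  exists (`|c x| + r / 2); split; first exact: num_real.
  move=> t tr u Cu /=; rewrite (le_trans _ (ltW tr))//.
  rewrite -[u](subrK (c x)) addrC (le_trans (ler_normD _ _))// lerD2l.
  by rewrite distrC.
have : nbhs x (chart_dom c `&` c @^-1` ball (c x) (r / 2)).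
  apply: open_nbhs_nbhs; split; last by split=> //; exact: ballxx.
  apply: open_preimage_for => *; [exact: chart_dom_open|exact: ball_open|exact: chart_fun_cts].
apply: filterS => y [cy yr]; exists (c y); last exact: chartK.
by move: yr; rewrite -ball_normE/= => /ltW.
Qed.

(** * The orbit map and the translation map *)

Section Orbit.
Context {R : realType} {n m : nat} {X : topologicalType} (A : set (chart R n X)).
Context {G : groupTopologicalType} (B : set (chart R m G)).
Variable act : X -> G -> X.
Hypotheses (X_manifold : smooth_manifold A) (G_lie : lie_group B)
  (act_action : right_action act)
  (act_smooth : smooth_map (prod_atlas A B) A (fun p : X * G => act p.1 p.2))
  (act_free : free_action act) (act_proper : proper_action act).
Variable x : X.

Let cA := manifold_cover X_manifold.
Let AA := manifold_compatible X_manifold.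
Let G_manifold : smooth_manifold B. Proof. by case: G_lie. Qed.
Let cB := manifold_cover G_manifold.
Let BB := manifold_compatible G_manifold.
Let mul_smooth : smooth_map (prod_atlas B B) B (fun p : G * G => (p.1 * p.2)%g).
Proof. by case: G_lie. Qed.
Let act1 y : act y 1%g = y. Proof. by case: act_action. Qed.
Let actM y g h : act y (g * h)%g = act (act y g) h. Proof. by case: act_action. Qed.

Local Notation phi := (act x).
Local Notation S := (action_orbit act x).

Lemma orbit_map_inj : injective phi.
Proof.
move=> g h gh; have : act x (g * h^-1)%g = x by rewrite actM gh -actM mulgV act1.
by move=> /act_free /(congr1 (fun k => k * h)%g); rewrite -mulgA mulVg mulg1 mul1g.
Qed.

Lemma orbit_map_smooth_at b a g : B b -> A a -> chart_dom b g -> chart_dom a (phi g) ->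
  smooth_at b a phi g.
Proof.
move=> Bb Aa bg ag.
exact: (@smooth_at_pairr _ _ _ _ _ _ _ _ _ _ (fun p : X * G => act p.1 p.2) cA act_smooth).
Qed.

Lemma orbit_map_continuous : continuous phi.
Proof.
move=> g; have [b Bb bg] := cB g; have [a Aa ag] := cA (phi g).
exact: smooth_at_continuous (orbit_map_smooth_at Bb Aa bg ag).
Qed.

(* [phi] factors as [act^~ k^-1 \o phi \o mulg^~ k]: its rank is the same everywhere. *)
Lemma orbit_map_rank_le b a b' a' g k : B b -> A a -> B b' -> A a' ->
  chart_dom b (g * k)%g -> chart_dom a (phi (g * k)%g) ->
  chart_dom b' g -> chart_dom a' (phi g) ->
  (\rank ('J (a' \o phi \o chart_inv b') (b' g))
     <= \rank ('J (a \o phi \o chart_inv b) (b (g * k)%g)))%N.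
Proof.
move=> Bb Aa Bb' Aa' bk ak bg ag.
pose F h := (h * k)%g : G; pose rho y := act y k^-1%g.
have sF : smooth_at b' b F g.
  exact: (@smooth_at_pairl _ _ _ _ _ _ _ _ _ _ (fun p : G * G => p.1 * p.2)%g cB mul_smooth).
have sphi : smooth_at b a phi (F g) by exact: orbit_map_smooth_at.
have phiE : rho \o (phi \o F) = phi.
  by apply/funext => h /=; rewrite /rho /F -actM -mulgA mulgV mulg1.
have phiEg : rho (phi (F g)) = phi g by rewrite -[in RHS]phiE.
have ag' : chart_dom a' (rho (phi (F g))) by rewrite phiEg.
have srho : smooth_at a a' rho (phi (F g)).
  exact: (@smooth_at_pairl _ _ _ _ _ _ _ _ _ _ (fun p : X * G => act p.1 p.2) cB act_smooth).
(* The chain rule writes the Jacobian of [phi] at [g] as a product of three, the middle one being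
   that of [phi] at [g * k]; the rank of a product is at most that of each factor. *)
have := smooth_at_jacobian_comp (smooth_at_comp sF sphi) srho.
rewrite phiE => ->; rewrite (smooth_at_jacobian_comp sF sphi).
by rewrite (leq_trans (mxrankM_maxl _ _))// mxrankM_maxr.
Qed.

Lemma orbit_map_immersion b a g : B b -> A a -> chart_dom b g -> chart_dom a (phi g) ->
  row_free ('J (a \o phi \o chart_inv b) (b g)).
Proof.
move=> Bb Aa bg ag; have [P [oP Pg Pb Pa sP]] := orbit_map_smooth_at Bb Aa bg ag.
have oW : open (b @` P) by exact: chart_image_open.
have Wg : (b @` P) (b g) by exists g.
apply: (constant_rank_injective oW sP Wg).
- move=> _ [h Ph <-].
  (* Right translation by [h^-1 * g] carries [h] to the base point [g]. *)
  have gE : (h * (h^-1 * g))%g = g by rewrite mulgA mulgV mul1g.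
  have := @orbit_map_rank_le b a b a h (h^-1 * g)%g Bb Aa Bb Aa.
  by rewrite gE; apply=> //; [exact: Pb|exact: Pa].
- move=> _ _ /[!inE] -[h Ph <-] [k Pk <-] /=; rewrite !chartK; try exact: Pb.
  by move=> /(chart_inj (Pa _ Ph) (Pa _ Pk)) /orbit_map_inj ->.
Qed.

(* Only the elements of the compact set [phi @^-1` K] need to be kept away. *)
Lemma orbit_map_open_embedding g (U : set G) : open U -> U g ->
  exists M, [/\ open M, M (phi g) & forall h, M (phi h) -> U h].
Proof.
move=> oU Ug; have [a Aa ag] := cA (phi g).
have [K cK nK] := chart_compact_nbhs ag.
have hX := manifold_hausdorff X_manifold.
(* Properness concerns the map on [X * G]: this set is the projection to [G] of the preimage of the
   compact product of the point [x] and [K]. *)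
have cC : compact (phi @^-1` K).
  have -> : phi @^-1` K =
      snd @` ((fun p : X * G => (p.1, act p.1 p.2)) @^-1` ([set x] `*` K)).
    apply/seteqP; split=> [h Kh|_ [[y h] [/= -> Kh] <-]] //.
    by exists (x, h).
  apply: continuous_compact.
    by apply: continuous_subspaceT => p; exact: cvg_snd.
  by apply: act_proper; apply: compact_setX => //; exact: compact_set1.
have cD : compact (phi @` (phi @^-1` K `&` ~` U)).
  apply: continuous_compact; first by apply: continuous_subspaceT; exact: orbit_map_continuous.
  by apply: compact_closedI => //; exact: open_closedC.
(* The removed set is compact, hence closed in the Hausdorff space [X], and it misses [phi g] by
   injectivity. *)
exists (interior K `&` ~` (phi @` (phi @^-1` K `&` ~` U))); split.
- apply: openI; first exact: open_interior.
  by apply: closed_openC; exact: compact_closed.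
- by split=> // -[h [_ nUh] /orbit_map_inj hg]; apply: nUh; rewrite hg.
- move=> h [/interior_subset Kh nD]; apply: contrapT => nUh; apply: nD.
  by exists h.
Qed.

(** The last clause covers every orbit point in the domain of [s], whichever group element produces
    it: this makes the orbit fill a single slice and makes the induced chart of the orbit read as
    [b]. *)
Lemma orbit_slice g : exists (b : chart R m G) (s : chart R n X),
  [/\ B b, slice_chart A m S s, chart_dom s (phi g) &
    forall h, chart_dom s (phi h) -> chart_dom b h /\ s (phi h) = b h *m pid_mx m].
Proof.
have [b Bb bg] := cB g; have [a Aa ag] := cA (phi g).
have [P [oP Pg Pb Pa sP]] := orbit_map_smooth_at Bb Aa bg ag.
have oW : open (b @` P) by exact: chart_image_open.
have Wg : (b @` P) (b g) by exists g.
have [Phi [Psi [N [[oN Ng NW sPhi Phif] [PhiK oV sPsi]]]]] :=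
  immersion_straighten oW sP Wg (orbit_map_immersion Bb Aa bg ag).
pose U : set G := P `&` (mulmxr (pid_mx m : 'M[R]_(m, n)) \o b) @^-1` N.
have oU : open U.
  apply: (open_preimage_for oP oN) => h Ph.
  apply: continuous_comp; first by apply: chart_fun_cts; exact: Pb.
  exact: mulmxr_continuous.
(* An orbit point of the new chart domain can then come only from [U], where [Psi] undoes [Phi] on
   the padded coordinates. *)
have [M [oM Mg MU]] := orbit_map_open_embedding oU (conj Pg Ng).
pose s := change_chart a oN oV PhiK sPhi sPsi oM.
have phih h : P h -> Phi (b h *m pid_mx m) = a (phi h).
  by move=> Ph; rewrite Phif /= chartK//; exact: Pb.
have sphi h : chart_dom s (phi h) -> P h /\ s (phi h) = b h *m pid_mx m.
  move=> [[_ Mh] _]; have [Ph Nh] := MU _ Mh; split=> //.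
  by rewrite /= -phih// PhiK ?inE.
have sg : chart_dom s (phi g).
  by split=> //; exists (b g *m pid_mx m) => //; exact: phih.
have mn : (m <= n)%N.
  by rewrite -(eqP (orbit_map_immersion Bb Aa bg ag)) rank_leq_col.
exists b, s; split=> //; last by move=> h /sphi[/Pb].
split; first exact: change_chart_maximal.
apply/seteqP; split=> [_ [y [sy [h _ hy]] <-]|_ [[y sy <-] sy0]].
  rewrite -hy in sy *; have sh := sy.
  split; first by exists (phi h).
  by move=> i mi; have [_ ->] := sphi h sh; rewrite mul_pid_wide0.
exists y => //; split=> //.
have [[ay My] [z Nz zy]] := sy.
have sE : s y = z by rewrite /= -zy PhiK ?inE.
(* Points of [N] truncate to coordinates of elements of [P], so a zero-padded point of the chart
   comes from a group element. *)
have [h Ph bh] := NW _ Nz.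
exists h => //; apply: (@chart_inj _ _ _ a) => //; first exact: Pa.
rewrite -phih// -zy bh -sE mul_pid_narrowK//.
Qed.

Lemma orbit_embedded : embedded_submanifold A m S.
Proof.
split.
  have [b Bb bg] := cB 1%g; have [a Aa ag] := cA (phi 1%g).
  by rewrite -(eqP (orbit_map_immersion Bb Aa bg ag)) rank_leq_col.
move=> _ [g _ <-]; have [b [s [_ ss sg _]]] := orbit_slice g.
by exists s.
Qed.

Definition orbit_map (g : G) : S := exist _ (phi g) (mem_set (ex_intro2 _ _ g I erefl)).

Lemma set_val_orbit_map g : set_val (orbit_map g) = phi g.
Proof. by []. Qed.

Lemma orbit_mapK : cancel orbit_map (@orbit_translation X G act x).
Proof.
move=> g; rewrite /orbit_translation set_val_orbit_map /translation_map.
by case: xgetP => [h _ /= /orbit_map_inj ->|/(_ g) []].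
Qed.

Lemma orbit_translationK : cancel (@orbit_translation X G act x) orbit_map.
Proof.
move=> y; have [g _ gy] := set_valP y.
have <- : orbit_map g = y by apply: set_val_inj; rewrite set_val_orbit_map gy.
by rewrite orbit_mapK.
Qed.

Let atlas := @submanifold_atlas R n X A m S.

Lemma orbit_manifold : smooth_manifold atlas.
Proof.
have [mn sS] := orbit_embedded.
apply: submanifold_smooth_manifold => //; first by exists x, 1%g.
- exact: manifold_hausdorff X_manifold.
- exact: manifold_second_countable X_manifold.
Qed.

(* In the charts of [orbit_slice], [orbit_map] and its inverse are the identity. *)
Lemma orbit_map_coordinates g : exists (b : chart R m G) (c : chart R m S),
  [/\ B b, atlas c, chart_dom b g, chart_dom c (orbit_map g) &
    smooth_at b c orbit_map g /\
    smooth_at c b (@orbit_translation X G act x) (orbit_map g)].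
Proof.
have [mn _] := orbit_embedded.
have [b [s [Bb ss sg sE]]] := orbit_slice g.
pose c := slice_restrict mn (orbit_map g) ss.
have cg : chart_dom c (orbit_map g) by [].
have [bg _] := sE g sg.
have cE h : chart_dom c (orbit_map h) -> chart_dom b h /\ c (orbit_map h) = b h.
  move=> ch; have [bh sh] := sE h ch; split=> //.
  by rewrite /= set_val_orbit_map sh mul_pid_wideK.
have om : continuous orbit_map.
  by move=> h; apply: continuous_for_set_val; exact: orbit_map_continuous.
pose P : set G := orbit_map @^-1` chart_dom c.
have oP : open P by apply: open_comp (chart_dom_open c) => h _; exact: om.
have smid (W : set 'rV[R]_m) : open W -> smooth_on W id.
  move=> oW; apply: smooth_on_ext (smooth_on_linear oW 1%:M) => // u _.
  by rewrite mulmx1.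
exists b, c; split=> //; first exact: slice_restrict_atlas.
split.
  exists P; split=> //; first by move=> h /cE[].
  have oW : open (b @` P) by apply: chart_image_open => // h /cE[].
  apply: smooth_on_ext (smid _ oW) => // _ /[!inE] -[h Ph <-] /=.
  by have [bh ch] := cE h Ph; rewrite -[LHS]ch /= chartK.
exists (chart_dom c); split=> //.
- exact: chart_dom_open.
- move=> y cy; have [] := cE (orbit_translation y) _; rewrite ?orbit_translationK//.
- have oW : open (c @` chart_dom c) by exact: chart_img_open.
  apply: (smooth_on_ext oW _ (smid _ oW)).
  move=> _ /[!inE] -[y cy <-].
  rewrite -[RHS]/(b (orbit_translation (chart_inv c (c y)))) chartK//.
  by have [] := cE (orbit_translation y) _; rewrite ?orbit_translationK.
Qed.

Lemma atlas_smooth_at_id c d y : atlas c -> atlas d -> chart_dom c y -> chart_dom d y ->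
  smooth_at c d id y.
Proof.
move=> Ac Ad cy dy; have [mn _] := orbit_embedded.
exact: (submanifold_smooth_at mn cA Ac Ad cy dy).
Qed.

(** [orbit_map_coordinates] provides one good pair of charts around each point; arbitrary charts are
    reached by transition maps on both sides. *)
Lemma smooth_orbit_map : smooth_map B atlas orbit_map.
Proof.
apply: smooth_map_of_smooth_at; [exact: cB|exact: manifold_cover orbit_manifold|].
move=> b c g Bb Ac bg cg; have [b' [c' [Bb' Ac' bg' cg' [so _]]]] := orbit_map_coordinates g.
have s1 := compatible_smooth_at (BB Bb Bb') bg bg'.
have s2 := atlas_smooth_at_id Ac' Ac cg' cg.
exact: (smooth_at_comp (smooth_at_comp s1 so) s2).
Qed.

Lemma smooth_orbit_translation : smooth_map atlas B (@orbit_translation X G act x).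
Proof.
apply: smooth_map_of_smooth_at; [exact: manifold_cover orbit_manifold|exact: cB|].
move=> c b y Ac Bb; rewrite -{1 3}[y]orbit_translationK.
move: (orbit_translation y) => g cg; rewrite -{1}[g]orbit_mapK => bg.
have [b' [c' [Bb' Ac' bg' cg' [_ so]]]] := orbit_map_coordinates g.
have s1 := atlas_smooth_at_id Ac Ac' cg cg'.
have bg'' : chart_dom b' (orbit_translation (orbit_map g)) by rewrite orbit_mapK.
have s2 := compatible_smooth_at (BB Bb' Bb) bg'' bg.
exact: (smooth_at_comp (smooth_at_comp s1 so) s2).
Qed.

End Orbit.

Theorem corollary5p3 (R : realType) (n m : nat)
    (X : topologicalType) (A : set (chart R n X))
    (G : groupTopologicalType) (B : set (chart R m G))
    (act : X -> G -> X)
    (X_manifold : smooth_manifold A)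
    (G_lie : lie_group B)
    (act_action : right_action act)
    (act_smooth : smooth_map (prod_atlas A B) A (fun p : X * G => act p.1 p.2))
    (act_free : free_action act)
    (act_proper : proper_action act) :
  forall x : X, exists k : nat,
    let orbit_atlas := @submanifold_atlas R n X A k (action_orbit act x) in
    [/\ embedded_submanifold A k (action_orbit act x),
        smooth_manifold orbit_atlas,
        diffeomorphic orbit_atlas B &
        smooth_map orbit_atlas B (@orbit_translation X G act x)].
Proof.
(* The orbit has the dimension of [G]. *)
move=> x; exists m => orbit_atlas; have st := smooth_orbit_translation X_manifold
  G_lie act_action act_smooth act_free act_proper x.
split=> //.
- exact: (orbit_embedded X_manifold G_lie act_action act_smooth act_free act_proper).
- exact: (orbit_manifold X_manifold G_lie act_action act_smooth act_free act_proper).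
- exists (@orbit_translation X G act x), (@orbit_map X G act x); split=> //.
  + exact: (orbit_translationK act_action act_free).
  + exact: (orbit_mapK act_action act_free).
  + exact: (smooth_orbit_map X_manifold G_lie act_action act_smooth act_free act_proper).
Qed.
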